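(* Let $\mu>0$, let $\mathcal{A}:\mathbb{M}_{n_1,n_2}\to\mathbb{F}^m$ be linear, let $b\in\mathbb{F}^m$, and let $K\ge1$ be an integer with $\delta_{2K}^-<1$. Set $$\mathcal{R}_\mu(X)=\mu\,\mathrm{rank}(X)+\|\mathcal{A}X-b\|^2,\qquad \mathcal{R}_{\mu,reg}(X)=\mathcal{Q}_2(\mu\,\mathrm{rank})(X)+\|\mathcal{A}X-b\|^2 .$$ Let $X'$ be a stationary point of $\mathcal{R}_{\mu,reg}$ with $\mathrm{rank}(X')\le K$, let $$Z'=(I-\mathcal{A}^*\mathcal{A})X'+\mathcal{A}^*b,$$ and assume that for every $i$ $$\sigma_i(Z')\notin\left[(1-\delta_{2K}^-)\sqrt{\mu},\ \frac{1}{1-\delta_{2K}^-}\sqrt{\mu}\right].$$ Then $X'$ is the unique solution to $$\operatorname*{arg\,min}_{\mathrm{rank}(X)\le K}\mathcal{R}_{\mu,reg}(X),$$ and moreover $\mathrm{rank}(X'')>K$ for any other stationary point $X''$ of $\mathcal{R}_{\mu,reg}$. Finally, if $\|\mathcal{A}\|<1$ and $\|\mathcal{A}X'-b\|^2\le\mu$, then $X'$ is a global minimizer of both $\mathcal{R}_\mu$ and $\mathcal{R}_{\mu,reg}$.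
   Context: $\mathbb{F}$ is $\mathbb{R}$ or $\mathbb{C}$, and $\mathbb{M}_{n_1,n_2}$ is the space of $n_1\times n_2$ matrices with entries in $\mathbb{F}$. Norms of matrices are Frobenius norms, norms of vectors are $\ell^2$-norms, $\|\mathcal{A}\|$ is the corresponding operator norm, and $\mathcal{A}^*$ is the adjoint of $\mathcal{A}$ with respect to the corresponding inner products. $\sigma_1(X)\ge\dots\ge\sigma_n(X)\ge 0$, $n=\min(n_1,n_2)$, are the singular values of $X$. An interval $[a,c]$ with $a>c$ is empty. For a functional $F$ on an inner product space $\mathcal{V}$, the quadratic envelope is $\mathcal{Q}_2(F)=\mathcal{S}_2(\mathcal{S}_2(F))$, where $\mathcal{S}_2(F)(Y)=\sup_{X\in\mathcal{V}}\big(-F(X)-\|X-Y\|^2\big)$; equivalently, for lower semicontinuous $[0,\infty]$-valued $F$, $\mathcal{Q}_2(F)(X)+\|X\|^2$ is the lower semicontinuous convex envelope of $F(X)+\|X\|^2$. Here $\mathcal{Q}_2(\mu\,\mathrm{rank})$ is the quadratic envelope of $X\mapsto\mu\,\mathrm{rank}(X)$ on $\mathbb{M}_{n_1,n_2}$; explicitly $\mathcal{Q}_2(\mu\,\mathrm{rank})(X)=\sum_i r_\mu(\sigma_i(X))$ with $r_\mu(\sigma)=\mu-\max(\sqrt{\mu}-\sigma,0)^2$. The lower restricted isometry constant $\delta_{J}^-$ of $\mathcal{A}$ is defined, for an integer $J\ge1$, by $$1-\delta_J^-=\inf\left\{\frac{\|\mathcal{A}X\|^2}{\|X\|^2}: X\in\mathbb{M}_{n_1,n_2},\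 X\ne 0,\ \mathrm{rank}(X)\le J\right\}.$$ A point $X$ is stationary for a functional $g$ if $\liminf_{Y\to X,\,Y\ne X}\frac{g(Y)-g(X)}{\|Y-X\|}\ge 0$. *)

(* Defs.v *)
From HB Require Import structures.
From mathcomp Require Import all_boot all_order all_algebra complex.
From mathcomp Require Import all_classical all_reals all_analysis.

Set Implicit Arguments.
Unset Strict Implicit.
Unset Printing Implicit Defensive.

Import Order.TTheory GRing.Theory Num.Theory.
Import numFieldNormedType.Exports.

Local Open Scope classical_set_scope.
Local Open Scope ring_scope.

(* The scalar field F is either the real field R or its complexification R[i]. *)
Inductive RorC := IsReal | IsComplex.

Section Scalars.
Variables (R : realType) (k : RorC).

Definition scalarF : numFieldType :=
  match k with IsReal => R | IsComplex => R[i] end.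

Definition conjF : scalarF -> scalarF :=
  match k return
    match k with IsReal => R : numFieldType | IsComplex => R[i] end ->
    match k with IsReal => R : numFieldType | IsComplex => R[i] end
  with IsReal => id | IsComplex => @conjc R end.

Definition ReF : scalarF -> R :=
  match k return
    match k with IsReal => R : numFieldType | IsComplex => R[i] end -> R
  with IsReal => id | IsComplex => @complex.Re R end.

Definition ofReal : R -> scalarF :=
  match k return
    R -> match k with IsReal => R : numFieldType | IsComplex => R[i] end
  with IsReal => id | IsComplex => fun x => (x%:C)%C end.

End Scalars.
Arguments conjF {R k} x.
Arguments ReF {R k} x.
Arguments ofReal {R} k x.

Section Norms.
Variables (R : realType) (k : RorC).
Local Notation F := (scalarF R k).

(* Frobenius inner product, linear in the first argument; on column vectors
   (n2 = 1) it is the standard inner product of F^m. *)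
Definition inner n1 n2 (X Y : 'M[F]_(n1, n2)) : F :=
  \sum_i \sum_j X i j * conjF (Y i j).

(* [`|x|] takes values in F, hence the real part. *)
Definition frob n1 n2 (X : 'M[F]_(n1, n2)) : R :=
  Num.sqrt (\sum_i \sum_j ReF `|X i j| ^+ 2).

Definition opnorm n1 n2 m (A : {linear 'M[F]_(n1, n2) -> 'cV[F]_m}) : R :=
  sup [set frob (A X) | X in [set X | frob X <= 1]].

Definition adjoint n1 n2 m (A : {linear 'M[F]_(n1, n2) -> 'cV[F]_m})
    (y : 'cV[F]_m) : 'M[F]_(n1, n2) :=
  \matrix_(i, j) inner y (A (delta_mx i j)).

Definition ctrmx n1 n2 (X : 'M[F]_(n1, n2)) : 'M[F]_(n2, n1) :=
  map_mx conjF X^T.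

Definition unitary n (U : 'M[F]_n) : Prop := U *m ctrmx U = 1%:M.

(* The n1 x n2 matrix with s on its main diagonal. *)
Definition rect_diag n1 n2 (s : 'rV[R]_(minn n1 n2)) : 'M[F]_(n1, n2) :=
  \matrix_(i < n1, j < n2)
    \sum_(l < minn n1 n2 | (l == i :> nat) && (l == j :> nat)) ofReal k (s 0 l).

Definition is_singular_values n1 n2 (X : 'M[F]_(n1, n2))
    (s : 'rV[R]_(minn n1 n2)) : Prop :=
  [/\ forall i, 0 <= s 0 i,
      forall i j : 'I_(minn n1 n2), (i <= j)%N -> s 0 j <= s 0 i
    & exists (U : 'M[F]_n1) (V : 'M[F]_n2),
        [/\ unitary U, unitary V & X = U *m rect_diag s *m ctrmx V]].

(* By the singular value theorem exactly one s qualifies, so that the default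
   value 0 of xget is never used. *)
Definition singular_values n1 n2 (X : 'M[F]_(n1, n2)) : 'rV[R]_(minn n1 n2) :=
  xget 0 [set s | is_singular_values X s].

(* The lower restricted isometry constant delta_J^-. *)
Definition lric n1 n2 m (A : {linear 'M[F]_(n1, n2) -> 'cV[F]_m}) (J : nat)
    : R :=
  1 - inf [set frob (A X) ^+ 2 / frob X ^+ 2
             | X in [set X : 'M[F]_(n1, n2) | X != 0 /\ (\rank X <= J)%N]].

End Norms.

Section Functionals.
Variables (R : realType) (k : RorC) (n1 n2 : nat).
Local Notation F := (scalarF R k).
Local Notation M := 'M[F]_(n1, n2).
Local Open Scope ereal_scope.

Definition S2 (f : M -> \bar R) (Y : M) : \bar R :=
  ereal_sup [set - f X - (frob (X - Y) ^+ 2)%:E | X in [set: M]].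

Definition Q2 (f : M -> \bar R) : M -> \bar R := S2 (S2 f).

Definition mu_rank (mu : R) (X : M) : \bar R := (mu * (\rank X)%:R)%:E.

Definition Rmu (mu : R) m (A : {linear M -> 'cV[F]_m}) (b : 'cV[F]_m) (X : M)
    : \bar R :=
  mu_rank mu X + (frob (A X - b) ^+ 2)%:E.

Definition Rmu_reg (mu : R) m (A : {linear M -> 'cV[F]_m}) (b : 'cV[F]_m)
    (X : M) : \bar R :=
  Q2 (mu_rank mu) X + (frob (A X - b) ^+ 2)%:E.

(* X^' is the filter of punctured neighbourhoods for the library's topology on
   matrices, which is that of the Frobenius norm. *)
Definition stationary (g : M -> \bar R) (X : M) : Prop :=
  0 <= limf_einf (fun Y => (g Y - g X) * ((frob (Y - X))^-1)%:E) X^'.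

Definition argmin (D : set M) (g : M -> \bar R) : set M :=
  [set X | D X /\ forall Y, D Y -> g X <= g Y].

End Functionals.

Section AdjointP.
Variables (R : realType) (k : RorC).
Local Notation F := (scalarF R k).

Lemma conjFD : {morph @conjF R k : x y / x + y}.
Proof. by case: k => // x y; exact: (rmorphD (@conjc R)). Qed.

Lemma conjFM : {morph @conjF R k : x y / x * y}.
Proof. by case: k => // x y; exact: (rmorphM (@conjc R)). Qed.

Lemma conjF0 : @conjF R k 0 = 0.
Proof. by case: k => //; exact: (rmorph0 (@conjc R)). Qed.

Lemma conjFK : involutive (@conjF R k).
Proof. by case: k => //; exact: (@conjcK R). Qed.

Lemma adjointP n1 n2 m (A : {linear 'M[F]_(n1, n2) -> 'cV[F]_m})
    (X : 'M[F]_(n1, n2)) (y : 'cV[F]_m) :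
  inner (A X) y = inner X (adjoint A y).
Proof.
have conj_sum I (r : seq I) (f : I -> F) :
    conjF (\sum_(i <- r) f i) = \sum_(i <- r) conjF (f i).
  exact: (big_morph _ conjFD conjF0).
rewrite {1}(matrix_sum_delta X) linear_sum /inner.
rewrite (eq_bigr (fun l => \sum_i \sum_j X i j * (A (delta_mx i j) l 0
   * conjF (y l 0)))); last first.
  move=> l _; rewrite big_ord1 summxE mulr_suml; apply: eq_bigr => i _.
  rewrite linear_sum summxE mulr_suml; apply: eq_bigr => j _.
  by rewrite linearZ mxE mulrA.
rewrite exchange_big; apply: eq_bigr => i _.
rewrite exchange_big; apply: eq_bigr => j _.
rewrite mxE -mulr_sumr conj_sum; congr (_ * _).
by apply: eq_bigr => l _; rewrite big_ord1 conjFM conjFK mulrC.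
Qed.

End AdjointP.

(* Main.v *)
(* Put E(X) = Q_2(mu rank)(X) + |X|^2, the convex envelope of
   G(X) = mu rank X + |X|^2, and Z(X) = X - A^*(A X - b), so that
   R_reg(Y) - R_reg(X)
     = E(Y) - E(X) - 2 Re<Z(X), Y - X> + |A(Y - X)|^2 - |Y - X|^2.
   If X is stationary, then 2 Z(X) is a subgradient of E at X.  A convex
   quadratic minorant of G is also one of E, so no closed form of E is needed.
   Let c = 1 - delta_2K^- <= 1 (if c > 1, convexity of E suffices) and let c' < c
   be so close to c that the gap in the singular values of Z' persists.  Then the
   hard thresholding T of Z' satisfies
   E(X) >= G(T) + 2 Re<Z', X - T> + (1 - c') |X - T|^2.
   Hence X' = T, and X' is a strict minimizer among matrices of rank at most K.
   Another stationary X'' of rank at most K is excluded by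
   Re<X'' - X', Z'' - Z'> >= (1 - c') |X'' - X'|^2,
   since Z'' - Z' = (I - A^*A)(X'' - X').  When X'' is a hard thresholding of
   Z'', this and the previous inequality reduce to scalar inequalities by
   expanding in the singular bases of both matrices, whose overlaps are dominated
   by a doubly substochastic array.  For a general pair, Z'' is moved by a small
   multiple of minus the gradient at X'' of the left side minus the right side, a
   concave function of X'', and a hard thresholding of the result replaces X''. *)
Require Import Defs.
From HB Require Import structures.
From mathcomp Require Import all_boot all_order all_fingroup all_algebra complex.
From mathcomp Require Import all_classical all_reals all_analysis.
From mathcomp Require Import ring lra.

Set Implicit Arguments.
Unset Strict Implicit.
Unset Printing Implicit Defensive.

Import Order.TTheory GRing.Theory Num.Theory.
Import numFieldNormedType.Exports.

Local Open Scope classical_set_scope.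
Local Open Scope ring_scope.

(** * Scalars and the real inner product *)

Section Scalars.
Variables (R : realType) (k : RorC).
Local Notation F := (scalarF R k).
Implicit Types (x y : F) (t : R).

Lemma conjF_additive : zmod_morphism (@conjF R k).
Proof. by case: k => // x y; exact: (rmorphB (@conjc R)). Qed.

Lemma conjF_multiplicative : monoid_morphism (@conjF R k).
Proof.
by split; [case: k => //; exact: (rmorph1 (@conjc R))|exact: conjFM].
Qed.

HB.instance Definition _ :=
  GRing.isZmodMorphism.Build F F (@conjF R k) conjF_additive.
HB.instance Definition _ :=
  GRing.isMonoidMorphism.Build F F (@conjF R k) conjF_multiplicative.

Lemma ofReal_additive : zmod_morphism (@ofReal R k).
Proof. by case: k => // x y; exact: (rmorphB (real_complex R)). Qed.

Lemma ofReal_multiplicative : monoid_morphism (@ofReal R k).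
Proof.
by case: k; split=> //; exact: (rmorphM (real_complex R)).
Qed.

HB.instance Definition _ :=
  GRing.isZmodMorphism.Build R F (@ofReal R k) ofReal_additive.
HB.instance Definition _ :=
  GRing.isMonoidMorphism.Build R F (@ofReal R k) ofReal_multiplicative.

Lemma ReF_additive : zmod_morphism (@ReF R k).
Proof. by case: k => // -[a b] [c d]. Qed.

HB.instance Definition _ :=
  GRing.isZmodMorphism.Build F R (@ReF R k) ReF_additive.

Lemma conjF_ofReal t : conjF (ofReal k t) = ofReal k t.
Proof. by case: k => //; exact: (@conjc_real R). Qed.

Lemma ReF_ofReal t : ReF (ofReal k t) = t.
Proof. by case: k. Qed.

Lemma ReF_conj x : ReF (conjF x) = ReF x.
Proof. by move: x; case: k => // -[a b]. Qed.

Lemma ReFZ t x : ReF (ofReal k t * x) = t * ReF x.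
Proof. by move: x; case: k => // -[a b] /=; rewrite mul0r subr0. Qed.

Lemma ReF_norm2 x : ReF `|x| ^+ 2 = ReF (x * conjF x).
Proof.
move: x; case: k => [x|[a b]] /=; first by rewrite real_normK ?num_real.
by rewrite sqr_sqrtr ?addr_ge0 ?sqr_ge0//; ring.
Qed.

Lemma mul_conjF x : x * conjF x = ofReal k (ReF (x * conjF x)).
Proof.
move: x; case: k => [x //|[a b]] /=.
by apply/eqP; rewrite eq_complex /= !eqxx /=; apply/eqP; ring.
Qed.

Lemma ReF_conj_ge0 x : 0 <= ReF (x * conjF x).
Proof. by rewrite -ReF_norm2 sqr_ge0. Qed.

Lemma ReF_conj_eq0 x : (ReF (x * conjF x) == 0) = (x == 0).
Proof.
apply/eqP/eqP => [h|->]; last by rewrite mul0r raddf0.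
have /eqP := mul_conjF x; rewrite h rmorph0 mulf_eq0 fmorph_eq0.
by case/orP => /eqP.
Qed.

Lemma ReF_mul_le x y :
  2 * ReF (x * y) <= ReF (x * conjF x) + ReF (y * conjF y).
Proof.
have := ReF_conj_ge0 (x - conjF y).
rewrite rmorphB /= conjFK mulrBl !mulrBr !raddfB /=.
rewrite -[ReF (conjF y * conjF x)]ReF_conj rmorphM /= !conjFK.
rewrite [y * x]mulrC [conjF y * y]mulrC; lra.
Qed.

End Scalars.

Section InnerProduct.
Variables (R : realType) (k : RorC).
Local Notation F := (scalarF R k).

(** The real part of [inner] makes matrices over either field a real Euclidean space, so that all
    convexity arguments below are real. *)
Definition rdot n1 n2 (X Y : 'M[F]_(n1, n2)) : R := ReF (inner X Y).

Lemma innerE n1 n2 (X Y : 'M[F]_(n1, n2)) : inner X Y = \tr (X *m ctrmx Y).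
Proof.
rewrite /inner /mxtrace; apply: eq_bigr => i _; rewrite mxE.
by apply: eq_bigr => j _; rewrite !mxE.
Qed.

Lemma rdotDl n1 n2 (X Y Z : 'M[F]_(n1, n2)) :
  rdot (X + Y) Z = rdot X Z + rdot Y Z.
Proof. by rewrite /rdot !innerE mulmxDl !raddfD. Qed.

Lemma rdotC n1 n2 (X Y : 'M[F]_(n1, n2)) : rdot X Y = rdot Y X.
Proof.
rewrite /rdot -ReF_conj /inner rmorph_sum; congr ReF.
apply: eq_bigr => i _; rewrite rmorph_sum; apply: eq_bigr => j _.
by rewrite rmorphM /= conjFK mulrC.
Qed.

Lemma rdotDr n1 n2 (X Y Z : 'M[F]_(n1, n2)) :
  rdot Z (X + Y) = rdot Z X + rdot Z Y.
Proof. by rewrite ![rdot Z _]rdotC rdotDl. Qed.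

Lemma rdotNl n1 n2 (X Z : 'M[F]_(n1, n2)) : rdot (- X) Z = - rdot X Z.
Proof. by rewrite /rdot !innerE mulNmx !raddfN. Qed.

Lemma rdotNr n1 n2 (X Z : 'M[F]_(n1, n2)) : rdot Z (- X) = - rdot Z X.
Proof. by rewrite ![rdot Z _]rdotC rdotNl. Qed.

Lemma rdotZl n1 n2 t (X Z : 'M[F]_(n1, n2)) :
  rdot (ofReal k t *: X) Z = t * rdot X Z.
Proof. by rewrite /rdot !innerE -scalemxAl linearZ /= ReFZ. Qed.

Lemma rdotZr n1 n2 t (X Z : 'M[F]_(n1, n2)) :
  rdot Z (ofReal k t *: X) = t * rdot Z X.
Proof. by rewrite ![rdot Z _]rdotC rdotZl. Qed.

Definition rdot_lin := (rdotDl, rdotDr, rdotNl, rdotNr, rdotZl, rdotZr).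

Lemma rdot0l n1 n2 (X : 'M[F]_(n1, n2)) : rdot 0 X = 0.
Proof. by rewrite /rdot innerE mul0mx !raddf0. Qed.

Lemma rdotE n1 n2 (X Y : 'M[F]_(n1, n2)) :
  rdot X Y = \sum_i \sum_j ReF (X i j * conjF (Y i j)).
Proof.
by rewrite /rdot /inner raddf_sum; apply: eq_bigr => i _; rewrite raddf_sum.
Qed.

Lemma rdot_ge0 n1 n2 (X : 'M[F]_(n1, n2)) : 0 <= rdot X X.
Proof.
by rewrite rdotE; do 2![apply: sumr_ge0 => ? _]; exact: ReF_conj_ge0.
Qed.

Lemma rdot_eq0 n1 n2 (X : 'M[F]_(n1, n2)) : (rdot X X == 0) = (X == 0).
Proof.
apply/eqP/eqP => [|->]; last exact: rdot0l.
rewrite rdotE => /eqP.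
rewrite psumr_eq0; last first.
  by move=> i _; apply: sumr_ge0 => j _; exact: ReF_conj_ge0.
move=> /allP h; apply/matrixP => i j; rewrite mxE.
have := h i (mem_index_enum i); rewrite /= psumr_eq0; last first.
  by move=> l _; exact: ReF_conj_ge0.
by move=> /allP /(_ j (mem_index_enum j)) /=; rewrite ReF_conj_eq0 => /eqP.
Qed.

Lemma rdot_gt0 n1 n2 (X : 'M[F]_(n1, n2)) : X != 0 -> 0 < rdot X X.
Proof. by move=> X0; rewrite lt_def rdot_eq0 X0 rdot_ge0. Qed.

Lemma frobE n1 n2 (X : 'M[F]_(n1, n2)) : frob X = Num.sqrt (rdot X X).
Proof.
rewrite rdotE /frob; congr Num.sqrt; apply: eq_bigr => i _.
by apply: eq_bigr => j _; rewrite ReF_norm2.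
Qed.

Lemma frob2 n1 n2 (X : 'M[F]_(n1, n2)) : frob X ^+ 2 = rdot X X.
Proof. by rewrite frobE sqr_sqrtr// rdot_ge0. Qed.

Lemma frob_gt0 n1 n2 (X : 'M[F]_(n1, n2)) : X != 0 -> 0 < frob X.
Proof. by move=> X0; rewrite frobE sqrtr_gt0 rdot_gt0. Qed.

Lemma rdot_le n1 n2 (X Y : 'M[F]_(n1, n2)) :
  2 * rdot X Y <= rdot X X + rdot Y Y.
Proof.
have := rdot_ge0 (X - Y); rewrite !rdot_lin [rdot Y X]rdotC; lra.
Qed.

Lemma rdot_adjoint n1 n2 m (A : {linear 'M[F]_(n1, n2) -> 'cV[F]_m}) X y :
  rdot (A X) y = rdot X (adjoint A y).
Proof. by rewrite /rdot adjointP. Qed.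

Lemma ctrmxK n1 n2 (X : 'M[F]_(n1, n2)) : ctrmx (ctrmx X) = X.
Proof. by apply/matrixP => i j; rewrite !mxE conjFK. Qed.

Lemma ctrmxM n1 n2 n3 (X : 'M[F]_(n1, n2)) (Y : 'M[F]_(n2, n3)) :
  ctrmx (X *m Y) = ctrmx Y *m ctrmx X.
Proof. by rewrite /ctrmx trmx_mul map_mxM. Qed.

Lemma rdot_mull n1 n2 n3 (X : 'M[F]_(n1, n2)) (Y : 'M[F]_(n2, n3)) Z :
  rdot (X *m Y) Z = rdot X (Z *m ctrmx Y).
Proof. by rewrite /rdot !innerE ctrmxM ctrmxK mulmxA. Qed.

Lemma rdot_mulr n1 n2 n3 (X : 'M[F]_(n1, n2)) (Y : 'M[F]_(n2, n3)) Z :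
  rdot (X *m Y) Z = rdot Y (ctrmx X *m Z).
Proof.
by rewrite /rdot !innerE ctrmxM ctrmxK -mulmxA mxtrace_mulC !mulmxA.
Qed.

End InnerProduct.

(** * Orthonormal rows and eigenvectors *)

Section Orthonormal.
Variables (R : realType) (k : RorC).
Local Notation F := (scalarF R k).

(** The rows of [Q] are orthonormal; [Q] need not be square, which is what thin decompositions
    require. *)
Definition orthorows r n (Q : 'M[F]_(r, n)) : Prop := Q *m ctrmx Q = 1%:M.

Lemma mulmx_ctrmx_rV n (v : 'rV[F]_n) :
  v *m ctrmx v = (ofReal k (rdot v v))%:M.
Proof.
rewrite [LHS]mx11_scalar; congr (_%:M); rewrite mxE /rdot /inner big_ord1.
rewrite raddf_sum rmorph_sum; apply: eq_bigr => j _.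
by rewrite !mxE [LHS]mul_conjF.
Qed.

Lemma orthorows_rV n (v : 'rV[F]_n) : orthorows v <-> rdot v v = 1.
Proof.
rewrite /orthorows mulmx_ctrmx_rV; split=> [/matrixP /(_ 0 0)|->]; last first.
  by rewrite rmorph1.
rewrite !mxE => /(congr1 (@ReF R k)).
by rewrite ReF_ofReal -(rmorph1 (@ofReal R k)) ReF_ofReal.
Qed.

Lemma normalize n (v : 'rV[F]_n) : v != 0 ->
  exists2 t : R, 0 < t & orthorows (ofReal k t *: v).
Proof.
move=> /rdot_gt0 v0; exists (Num.sqrt (rdot v v))^-1.
  by rewrite invr_gt0 sqrtr_gt0.
apply/orthorows_rV; rewrite rdotZl rdotZr mulrA -expr2 exprVn.
by rewrite sqr_sqrtr ?ltW// mulVf// gt_eqF.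
Qed.

Lemma orthorows_free r n (Q : 'M[F]_(r, n)) : orthorows Q -> row_free Q.
Proof. by move=> QQ; apply/row_freeP; exists (ctrmx Q). Qed.

Lemma orthorows_proj r p n (Q : 'M[F]_(r, n)) (W : 'M[F]_(p, n)) :
  orthorows Q -> (W <= Q)%MS -> W *m ctrmx Q *m Q = W.
Proof. by move=> QQ /submxP[D ->]; rewrite -(mulmxA D) QQ mulmx1. Qed.

Lemma orthorows_col_mx r1 r2 n (Q1 : 'M[F]_(r1, n)) (Q2 : 'M[F]_(r2, n)) :
  orthorows Q1 -> orthorows Q2 -> Q1 *m ctrmx Q2 = 0 ->
  orthorows (col_mx Q1 Q2).
Proof.
move=> h1 h2 h12; rewrite /orthorows /ctrmx tr_col_mx map_row_mx mul_col_row.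
rewrite -/(ctrmx Q1) -/(ctrmx Q2) h1 h2 h12.
rewrite -[Q2 *m _]ctrmxK ctrmxM ctrmxK h12 /ctrmx trmx0 map_mx0.
by rewrite -scalar_mx_block.
Qed.

(** Gram-Schmidt, by induction on [q - r]: adjoin the normalized part, orthogonal to [Q], of a row
    of [W] outside the row space of [Q]. The size [q] is tied to [\rank W] by an equation, so that
    it can be any expression convertible or provably equal to the rank. *)
Lemma orthorows_extend p n (W : 'M[F]_(p, n)) (q r : nat) (Q : 'M[F]_(r, n)) :
  \rank W = q -> orthorows Q -> (Q <= W)%MS ->
  exists Q' : 'M[F]_(q, n), [/\ orthorows Q', (Q' <= W)%MS, (W <= Q')%MS &
    forall (i : 'I_r) (j : 'I_q), i = j :> nat -> row i Q = row j Q'].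
Proof.
move=> Wq QQ QW; have := mxrankS QW.
rewrite (eqP (orthorows_free QQ)) Wq => /subnK; move: (q - r)%N => d.
elim: d r Q QQ QW => [|d IH] r Q QQ QW dr.
  rewrite add0n in dr; case: q / dr Wq => Wr.
  exists Q; split=> // [|i j /ord_inj -> //].
  have := mxrank_leqif_sup QW; rewrite (eqP (orthorows_free QQ)) Wr.
  by move=> /geq_leqif <-.
have /row_subPn[i iQ] : ~~ (W <= Q)%MS.
  apply/negP => /mxrankS; rewrite (eqP (orthorows_free QQ)) Wq -dr addSn.
  by rewrite ltnNge leq_addl.
set y := row i W - row i W *m ctrmx Q *m Q.
have yQ : y *m ctrmx Q = 0.
  by rewrite mulmxBl -(mulmxA _ Q) QQ mulmx1 subrr.
have y0 : y != 0.
  apply: contra iQ; rewrite subr_eq0 => /eqP ->; exact: submxMl.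
have yW : (y <= W)%MS.
  by rewrite addmx_sub ?row_sub// eqmx_opp mulmx_sub.
have [t t0 ty] := normalize y0.
have [|||Q' [Q'1 Q'W WQ' Q'Q]] := IH _ (col_mx Q (ofReal k t *: y)).
- apply: orthorows_col_mx => //.
  rewrite -[LHS]ctrmxK ctrmxM ctrmxK -scalemxAl yQ scaler0.
  by rewrite /ctrmx trmx0 map_mx0.
- by rewrite col_mx_sub QW scalemx_sub.
- by rewrite addn1 addnS.
exists Q'; split=> // a b ab; rewrite -(Q'Q (lshift 1 a))//.
by rewrite rowKu.
Qed.

End Orthonormal.

Section Eigen.
Variable R : realType.

(** Over the complex field an eigenvalue exists by algebraic closedness. A real symmetric matrix is
    complexified: its eigenvalue [a + ib] turns out real, and the real or the imaginary part of the
    eigenvector is a real eigenvector. *)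
Lemma hermitian_eigen (k : RorC) n (H : 'M[scalarF R k]_n.+1) : ctrmx H = H ->
  exists2 x : 'rV[scalarF R k]_n.+1, x != 0 & exists a, x *m H = a *: x.
Proof.
case: k H => [|] H HH; last first.
  have [a /eigenvalueP[v vH v0]] := @eigenvalue_closed R[i] n.+1 H isT.
  by exists v => //; exists a.
have {}HH i j : H i j = H j i by rewrite -[in LHS]HH !mxE.
have [[a b] /eigenvalueP[v vH v0]] :=
  @eigenvalue_closed R[i] n.+1 (map_mx (real_complex R) H) isT.
have [x xE] : exists x : 'rV[R]_n.+1, forall l, x 0 l = complex.Re (v 0 l).
  by exists (map_mx (@complex.Re R) v) => l; rewrite mxE.
have [y yE] : exists y : 'rV[R]_n.+1, forall l, y 0 l = complex.Im (v 0 l).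
  by exists (map_mx (@complex.Im R) v) => l; rewrite mxE.
have vE j l : v 0 j * (H j l)%:C%C = Complex (x 0 j * H j l) (y 0 j * H j l).
  rewrite xE yE; case: (v 0 j) => c d; apply/eqP; rewrite eq_complex /=.
  by rewrite !mulr0 subr0 add0r !eqxx.
have sumC (f g : 'I_n.+1 -> R) :
    \sum_j Complex (f j) (g j) = Complex (\sum_j f j) (\sum_j g j) :> R[i].
  apply/eqP; rewrite eq_complex; apply/andP; split; apply/eqP.
    by rewrite (raddf_sum (@complex.Re R)).
  by rewrite (raddf_sum (@complex.Im R)).
have vHl l : (x *m H) 0 l = a * x 0 l - b * y 0 l /\
             (y *m H) 0 l = b * x 0 l + a * y 0 l.
  have := congr1 (fun M : 'rV[R[i]]_n.+1 => M 0 l) vH.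
  rewrite !mxE (eq_bigr (fun j => Complex (x 0 j * H j l) (y 0 j * H j l)));
    last first.
    by move=> j _; rewrite -vE mxE.
  rewrite sumC xE yE; case: (v 0 l) => [c d]; case=> -> ->; split => //.
  by rewrite addrC.
(* By symmetry of [H], <yH, x> - <xH, y> vanishes; it also equals b(|x|^2 + |y|^2). *)
have b0 : b = 0.
  have e1 : \sum_l (x *m H) 0 l * y 0 l = \sum_l (y *m H) 0 l * x 0 l.
    under eq_bigr do rewrite mxE mulr_suml.
    rewrite exchange_big; apply: eq_bigr => l _; rewrite mxE mulr_suml.
    by apply: eq_bigr => j _; rewrite HH; ring.
  have : b * \sum_l (x 0 l ^+ 2 + y 0 l ^+ 2) = 0.
    transitivity (\sum_l ((y *m H) 0 l * x 0 l - (x *m H) 0 l * y 0 l)).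
      rewrite mulr_sumr; apply: eq_bigr => l _.
      by case: (vHl l) => -> ->; ring.
    by rewrite sumrB e1 subrr.
  move=> /eqP; rewrite mulf_eq0 => /orP[/eqP //|].
  rewrite psumr_eq0 => [/allP h|l _]; last by rewrite addr_ge0 ?sqr_ge0.
  case/eqP: v0; apply/rowP => l; have := h l (mem_index_enum l).
  rewrite /= paddr_eq0 ?sqr_ge0// !sqrf_eq0 xE yE mxE => /andP[/eqP h1 /eqP h2].
  by apply/eqP; rewrite eq_complex h1 h2 !eqxx.
have xH : x *m H = a *: x.
  by apply/rowP => l; case: (vHl l) => -> _; rewrite b0 mxE mul0r subr0.
have yH : y *m H = a *: y.
  by apply/rowP => l; case: (vHl l) => _ ->; rewrite b0 mxE mul0r add0r.
have [x0|x0] := eqVneq x 0; last by exists x => //; exists a.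
exists y; last by exists a.
apply: contra v0 => /eqP y0; apply/eqP/rowP => l.
have := congr1 (fun M : 'rV[R]_n.+1 => M 0 l) x0.
have := congr1 (fun M : 'rV[R]_n.+1 => M 0 l) y0.
by rewrite xE yE !mxE; case: (v 0 l) => c d /= -> ->.
Qed.

End Eigen.

Section SVD.
Variables (R : realType) (k : RorC).
Local Notation F := (scalarF R k).

(** A unit eigenvector v of Z^* Z, with u the normalization of v Z^*. Compressing Z^* Z to the row
    space of Z, with orthonormal basis [Q], keeps v in that space, hence the eigenvalue is
    nonzero. *)
Lemma singular_pair n1 n2 (Z : 'M[F]_(n1, n2)) : Z != 0 ->
  exists (s : R) (u : 'rV[F]_n1) (v : 'rV[F]_n2),
    [/\ 0 < s, orthorows u, orthorows v,
        u *m Z = ofReal k s *: v & v *m ctrmx Z = ofReal k s *: u].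
Proof.
move=> Z0; have : (0 < \rank Z)%N by rewrite lt0n mxrank_eq0.
case r : (\rank Z) => [//|r'] _.
have [||Q [QQ QZ ZQ _]] := @orthorows_extend R k _ _ Z r'.+1 0 (0 : 'M[F]_(0, n2)) r.
- by rewrite /orthorows mul0mx; apply/matrixP => -[].
- exact: sub0mx.
have ZE := orthorows_proj QQ ZQ.
have [|x x0 [a xH]] := @hermitian_eigen R k _ (Q *m ctrmx Z *m Z *m ctrmx Q).
  by rewrite !ctrmxM !ctrmxK !mulmxA.
pose w := x *m Q.
have w0 : w != 0.
  apply: contra x0 => /eqP w0; apply/eqP.
  by rewrite -(mulmx1 x) -QQ mulmxA -/w w0 mul0mx.
have wZ : w *m ctrmx Z *m Z = a *: w.
  by rewrite /w scalemxAl -xH -[X in _ *m X = _]ZE !mulmxA.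
have [t t0 v1] := normalize w0.
set v := ofReal k t *: w in v1.
have vZ : v *m ctrmx Z *m Z = a *: v
  by rewrite /v -!scalemxAl wZ scalerA mulrC -scalerA.
pose u := v *m ctrmx Z.
(* As v = D Z, the square norm of v is <D, v Z^*>, which would vanish with u. *)
have u0 : u != 0.
  apply/negP => /eqP u0; have [D vD] : exists D, v = D *m Z.
    by apply/submxP; rewrite scalemx_sub// /w mulmx_sub.
  have := orthorows_rV v; case=> /(_ v1) + _.
  rewrite {2}vD rdotC rdot_mull -/u u0 rdotC rdot0l => /esym/eqP.
  by rewrite oner_eq0.
have aE : a = ofReal k (rdot u u).
  have : u *m ctrmx u = a%:M.
    by rewrite {2}/u ctrmxM ctrmxK mulmxA vZ -scalemxAl v1 scalemx1.
  by rewrite mulmx_ctrmx_rV => /matrixP /(_ 0 0); rewrite !mxE.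
pose s := Num.sqrt (rdot u u).
have s0 : 0 < s by rewrite sqrtr_gt0 rdot_gt0.
have sE : rdot u u = s * s by rewrite -expr2 sqr_sqrtr// rdot_ge0.
exists s, (ofReal k s^-1 *: u), v; split => //.
- by apply/orthorows_rV; rewrite rdotZl rdotZr sE; field; rewrite gt_eqF.
- rewrite -scalemxAl vZ aE sE scalerA -rmorphM /=; congr (ofReal k _ *: _).
  by field; rewrite gt_eqF.
- by rewrite scalerA -rmorphM /= mulfV ?gt_eqF// rmorph1 scale1r.
Qed.

End SVD.

(** * Singular value decomposition *)

Section SVD.
Variables (R : realType) (k : RorC).
Local Notation F := (scalarF R k).

Definition rdiag r (s : 'rV[R]_r) : 'M[F]_r := diag_mx (map_mx (@ofReal R k) s).

(** The sum of s_i u_i^* v_i over the rows u_i of [U] and v_i of [V]; neither sign nor order of the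
    s_i is prescribed. *)
Definition svdmx r n1 n2 (U : 'M[F]_(r, n1)) (s : 'rV[R]_r)
  (V : 'M[F]_(r, n2)) : 'M[F]_(n1, n2) := ctrmx U *m rdiag s *m V.

Lemma ctrmxB n1 n2 (X Y : 'M[F]_(n1, n2)) : ctrmx (X - Y) = ctrmx X - ctrmx Y.
Proof. by apply/matrixP => i j; rewrite !mxE rmorphB. Qed.

Lemma ctrmxZ n1 n2 a (X : 'M[F]_(n1, n2)) : ctrmx (a *: X) = conjF a *: ctrmx X.
Proof. by apply/matrixP => i j; rewrite !mxE rmorphM. Qed.

Lemma ctrmx_rdiag r (s : 'rV[R]_r) : ctrmx (rdiag s) = rdiag s.
Proof.
rewrite /ctrmx /rdiag tr_diag_mx map_diag_mx -map_mx_comp; congr diag_mx.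
by apply/rowP => i; rewrite !mxE /= conjF_ofReal.
Qed.

Lemma rdiag_unit r (s : 'rV[R]_r) : (forall i, 0 < s 0 i) ->
  rdiag s \in unitmx.
Proof.
move=> s0; rewrite unitmxE unitfE det_diag prodf_seq_neq0; apply/allP => i _ /=.
by rewrite mxE fmorph_eq0 gt_eqF.
Qed.

Lemma rank_rdiag_le r (s : 'rV[R]_r) :
  (\rank (rdiag s) <= \sum_i (s 0 i != 0)%R)%N.
Proof.
rewrite /rdiag diag_mx_sum_delta.
elim/big_rec2: _ => [|i q M _ h]; first by rewrite mxrank0.
apply: (leq_trans (mxrank_add _ _)); rewrite leq_add// mxE.
have [->|s0] := eqVneq (s 0 i) 0; first by rewrite rmorph0 scale0r mxrank0.
by rewrite mxrank_scale_nz ?mxrank_delta// fmorph_eq0.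
Qed.

Lemma rank_svdmx_le r n1 n2 (U : 'M[F]_(r, n1)) (s : 'rV[R]_r)
    (V : 'M[F]_(r, n2)) :
  (\rank (svdmx U s V) <= \sum_i (s 0 i != 0)%R)%N.
Proof.
apply: leq_trans (rank_rdiag_le s).
exact: leq_trans (mxrankM_maxl _ _) (mxrankM_maxr _ _).
Qed.

Lemma rank_svdmx_ge r n1 n2 (U : 'M[F]_(r, n1)) (s : 'rV[R]_r)
    (V : 'M[F]_(r, n2)) :
  orthorows U -> orthorows V -> (forall i, 0 < s 0 i) ->
  (r <= \rank (svdmx U s V))%N.
Proof.
move=> UU VV s0; rewrite -[leqLHS](mxrank_unit (rdiag_unit s0)).
have <- : U *m svdmx U s V *m ctrmx V = rdiag s.
  by rewrite /svdmx !mulmxA UU mul1mx -mulmxA VV mulmx1.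
exact: leq_trans (mxrankM_maxl _ _) (mxrankM_maxr _ _).
Qed.

(* Deflation by a singular pair (u, v) lowers the rank, because v lies in the
   row space of Z but is orthogonal to the row space of the remainder. *)
Lemma svd_pos n1 n2 (Z : 'M[F]_(n1, n2)) :
  exists r (s : 'rV[R]_r) (U : 'M[F]_(r, n1)) (V : 'M[F]_(r, n2)),
    [/\ orthorows U, orthorows V, forall i, 0 < s 0 i & Z = svdmx U s V].
Proof.
have [N] := ubnP (\rank Z); elim: N Z => // N IH Z; rewrite ltnS => ZN.
have [->|Z0] := eqVneq Z 0.
  exists 0%N, 0, 0, 0; split.
  - by rewrite /orthorows mul0mx; apply/matrixP => -[].
  - by rewrite /orthorows mul0mx; apply/matrixP => -[].
  - by case.
  - by rewrite /svdmx mulmx0.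
have [t [u [v [t0 uu vv uZ vZ]]]] := singular_pair Z0.
pose Z1 := Z - ofReal k t *: (ctrmx u *m v).
have uZ1 : u *m Z1 = 0.
  by rewrite mulmxBr -scalemxAr mulmxA uu mul1mx uZ subrr.
have ZZ1 : v *m ctrmx Z1 = 0.
  rewrite ctrmxB ctrmxZ conjF_ofReal ctrmxM ctrmxK.
  by rewrite mulmxBr -scalemxAr mulmxA vv mul1mx vZ subrr.
have t_neq0 : ofReal k t != 0 by rewrite fmorph_eq0 gt_eqF.
have vE : v = (ofReal k t)^-1 *: (u *m Z).
  by rewrite uZ scalerA mulVf// scale1r.
have Z1Z : (Z1 <= Z)%MS.
  rewrite addmx_sub// eqmx_opp scalemx_sub// mulmx_sub// vE scalemx_sub//.
  exact: submxMl.
have Z1N : (\rank Z1 < N)%N.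
  apply: leq_trans ZN; rewrite (ltn_leqif (mxrank_leqif_sup Z1Z)).
  apply/negP => /(submx_trans (submxMl u Z)) /submxP[D DE].
  have : v *m ctrmx v = 0.
    have Z1v : Z1 *m ctrmx v = 0.
      by rewrite -[LHS]ctrmxK ctrmxM ctrmxK ZZ1 /ctrmx trmx0 map_mx0.
    by rewrite {1}vE DE -scalemxAl -mulmxA Z1v mulmx0 scaler0.
  by rewrite vv => /matrixP /(_ 0 0) /eqP; rewrite !mxE /= oner_eq0.
have [r [s [U [V [UU VV s0 Z1E]]]]] := IH _ Z1N.
have sU := rdiag_unit s0.
(* Orthogonality of u to Z1 passes to the singular vectors of Z1 because [rdiag s] is invertible. *)
have uU : u *m ctrmx U = 0.
  have e : u *m ctrmx U *m rdiag s = u *m Z1 *m ctrmx V.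
    by rewrite Z1E /svdmx -!mulmxA VV mulmx1.
  by rewrite -(mulmxK sU (u *m ctrmx U)) e uZ1 !mul0mx.
have vV : v *m ctrmx V = 0.
  have e : v *m ctrmx V *m rdiag s = v *m ctrmx Z1 *m ctrmx U.
    by rewrite Z1E /svdmx !ctrmxM ctrmxK ctrmx_rdiag -!mulmxA UU mulmx1.
  by rewrite -(mulmxK sU (v *m ctrmx V)) e ZZ1 !mul0mx.
exists (1 + r)%N, (row_mx t%:M s), (col_mx u U), (col_mx v V); split.
- exact: orthorows_col_mx.
- exact: orthorows_col_mx.
- move=> i; rewrite mxE; case: fintype.splitP => j _; last exact: s0.
  by rewrite ord1 mxE eqxx mulr1n.
- rewrite /svdmx /rdiag map_row_mx diag_mx_row /ctrmx tr_col_mx map_row_mx.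
  rewrite mul_row_block !mulmx0 addr0 add0r mul_row_col -/(svdmx U s V) -Z1E.
  have -> : diag_mx (map_mx (@ofReal R k) t%:M) = (ofReal k t)%:M :> 'M[F]_1.
    by apply/matrixP => i j; rewrite !ord1 !mxE eqxx !mulr1n.
  by rewrite mul_mx_scalar -scalemxAl /Z1 addrC subrK.
Qed.

Lemma svdmx_perm r n1 n2 (p : 'S_r) (U : 'M[F]_(r, n1)) (s : 'rV[R]_r)
    (V : 'M[F]_(r, n2)) :
  svdmx (row_perm p U) (col_perm p s) (row_perm p V) = svdmx U s V.
Proof.
apply/matrixP => i j; rewrite /svdmx /rdiag !mul_mx_diag !mxE.
rewrite [RHS](reindex_inj (@perm_inj _ p)); apply: eq_bigr => l _.
by rewrite !mxE.
Qed.

Lemma orthorows_perm r n (p : 'S_r) (U : 'M[F]_(r, n)) :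
  orthorows U -> orthorows (row_perm p U).
Proof.
move=> UU; rewrite /orthorows /ctrmx tr_row_perm map_col_perm.
rewrite row_permE col_permE mulmxA -(mulmxA _ U) -/(ctrmx U) UU mulmx1.
by rewrite -perm_mxM mulgV perm_mx1.
Qed.

Lemma sort_row r (s : 'rV[R]_r) : exists p : 'S_r,
  forall i j : 'I_r, (i <= j)%N -> col_perm p s 0 j <= col_perm p s 0 i.
Proof.
pose t := [tuple s 0 i | i < r].
have /tuple_permP[p pE] : perm_eq (sort >=%R t) t by rewrite perm_sort.
exists p => i j ij; rewrite !mxE.
have nthE l : s 0 (p l) = nth 0 (sort >=%R t) l.
  by rewrite pE -tnth_nth !tnth_mktuple.
rewrite !nthE; apply: (sorted_leq_nth (leT := >=%R)) => //.
- by move=> a b c /= h1 h2; exact: le_trans h2 h1.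
- by move=> a /=; exact: lexx.
- by apply: sort_sorted; exact: ge_total.
- by rewrite inE size_sort size_tuple.
- by rewrite inE size_sort size_tuple.
Qed.

Lemma pid_mxE r n : (r <= n)%N ->
  (pid_mx r : 'M[F]_(r, n)) *m ctrmx (pid_mx r : 'M[F]_(r, n)) = 1%:M.
Proof.
move=> rn; rewrite /ctrmx tr_pid_mx map_pid_mx mul_pid_mx.
by rewrite minnn (minn_idPr rn) pid_mx_1.
Qed.

Lemma rect_svdE r n1 n2 (s : 'rV[R]_r) : (r <= n1)%N -> (r <= n2)%N ->
  svdmx (pid_mx r) s (pid_mx r) = \matrix_(i < n1, j < n2)
    \sum_(l < r | (l == i :> nat) && (l == j :> nat)) ofReal k (s 0 l).
Proof.
move=> r1 r2; apply/matrixP => i j; rewrite /svdmx mul_mx_diag !mxE.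
rewrite [RHS]big_mkcond; apply: eq_bigr => l _; rewrite !mxE ltn_ord !andbT.
case: eqP => _; case: eqP => _ /=; rewrite ?mulr0 ?rmorph0 ?mul0r ?mulr1//.
by rewrite rmorph1 mul1r.
Qed.

(** The positive thin decomposition is sorted, its bases are completed to unitary matrices and its
    values are padded by zeros; so [xget] returns genuine singular values. *)
Lemma singular_values_exist n1 n2 (Z : 'M[F]_(n1, n2)) :
  is_singular_values Z (singular_values Z).
Proof.
apply: xgetPex.
have [r [s0 [U0 [V0 [UU0 VV0 s_gt0 ZE0]]]]] := svd_pos Z.
have [p] := sort_row s0; have := svdmx_perm p U0 s0 V0.
have : forall i, 0 < col_perm p s0 0 i by move=> i; rewrite mxE.
have := orthorows_perm p VV0; have := orthorows_perm p UU0.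
rewrite -ZE0; move: (row_perm p U0) (col_perm p s0) (row_perm p V0).
move=> U s V UU VV s0' ZE s_dec {U0 V0 s0 UU0 VV0 s_gt0 ZE0}.
have rk n (Q : 'M[F]_(r, n)) : orthorows Q -> (r <= n)%N.
  by move=> /orthorows_free /eqP <-; exact: rank_leq_col.
have r1 := rk _ _ UU; have r2 := rk _ _ VV.
have rm : (r <= minn n1 n2)%N by rewrite leq_min r1.
have [U' [UU' _ _ U'U]] := orthorows_extend (mxrank1 F n1) UU (submx1 _).
have [V' [VV' _ _ V'V]] := orthorows_extend (mxrank1 F n2) VV (submx1 _).
have pidE n (Q : 'M[F]_(r, n)) (Q' : 'M[F]_n) : (r <= n)%N ->
    (forall (i : 'I_r) (j : 'I_n), i = j :> nat -> row i Q = row j Q') ->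
    Q = pid_mx r *m Q'.
  move=> rn QQ'; apply/row_matrixP => i.
  rewrite (QQ' i (widen_ord rn i))// row_mul [LHS]rowE; congr (_ *m _).
  by apply/rowP => j; rewrite !mxE ltn_ord andbT eq_sym.
(* At most one term of the sum is present, and none beyond [r]: this is [s] padded by zeros. *)
pose s' : 'rV[R]_(minn n1 n2) := \row_l \sum_(i < r | i == l :> nat) s 0 i.
have s'lt (l : 'I_(minn n1 n2)) (lr : (l < r)%N) : s' 0 l = s 0 (Ordinal lr).
  by rewrite mxE (big_pred1 (Ordinal lr)).
have s'ge (l : 'I_(minn n1 n2)) : (r <= l)%N -> s' 0 l = 0.
  move=> rl; rewrite mxE big_pred0// => i; apply/negbTE.
  by rewrite neq_ltn (leq_trans (ltn_ord i) rl).
have s'_ge0 l : 0 <= s' 0 l.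
  by rewrite mxE; apply: sumr_ge0 => i _; rewrite ltW.
exists s'; split=> //.
  move=> i j ij; have [rj|jr] := leqP r j; first by rewrite s'ge.
  by rewrite (s'lt _ jr) (s'lt _ (leq_ltn_trans ij jr)) s_dec.
exists (ctrmx U'), (ctrmx V'); split.
- by rewrite /unitary ctrmxK; exact: mulmx1C.
- by rewrite /unitary ctrmxK; exact: mulmx1C.
rewrite ctrmxK.
have -> : rect_diag k s' = svdmx (pid_mx r) s (pid_mx r).
  rewrite rect_svdE//; apply/matrixP => i j; rewrite !mxE.
  under eq_bigr do rewrite mxE rmorph_sum /=.
  rewrite (exchange_big_dep
    (fun l : 'I_r => (l == i :> nat) && (l == j :> nat)))/=; last first.
    by move=> l l' /andP[/eqP <- /eqP <-] /eqP ->; rewrite eqxx.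
  apply: eq_bigr => l /andP[/eqP li /eqP lj].
  rewrite (big_pred1 (widen_ord rm l))// => l'.
  by rewrite /= -val_eqE /= -li -lj andbb [l == l' :> nat]eq_sym andbb.
by rewrite -ZE (pidE _ _ _ r1 U'U) (pidE _ _ _ r2 V'V) /svdmx ctrmxM !mulmxA.
Qed.

(** Only the first [minn n1 n2] singular vectors on each side meet the rectangular diagonal; keeping
    those gives a thin decomposition. *)
Lemma singular_values_svd n1 n2 (Z : 'M[F]_(n1, n2)) :
  exists (U : 'M[F]_(minn n1 n2, n1)) (V : 'M[F]_(minn n1 n2, n2)),
    [/\ orthorows U, orthorows V, forall i, 0 <= singular_values Z 0 i
      & Z = svdmx U (singular_values Z) V].
Proof.
have [s0 _ [U [V [UU VV ZE]]]] := singular_values_exist Z.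
have pid_on n (Q : 'M[F]_n) : (minn n1 n2 <= n)%N -> unitary Q ->
    orthorows (pid_mx (minn n1 n2) *m ctrmx Q : 'M[F]_(minn n1 n2, n)).
  move=> rn QQ; rewrite /orthorows ctrmxM ctrmxK mulmxA.
  rewrite -(mulmxA _ (ctrmx Q)) (mulmx1C QQ) mulmx1; exact: pid_mxE.
exists (pid_mx (minn n1 n2) *m ctrmx U), (pid_mx (minn n1 n2) *m ctrmx V).
split=> //; try by apply: pid_on; rewrite ?geq_minl ?geq_minr.
rewrite {1}ZE /rect_diag -rect_svdE ?geq_minl ?geq_minr//.
by rewrite /svdmx !ctrmxM !ctrmxK !mulmxA.
Qed.

End SVD.

(** * Overlaps of two singular bases *)

Section TwoBases.
Variables (R : realType) (k : RorC) (n1 n2 : nat).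
Local Notation F := (scalarF R k).

Lemma conjF1 : conjF (1 : F) = 1.
Proof. exact: rmorph1. Qed.

(** The real inner product of the rank-one matrices u_i^* v_i and u'_j^* v'_j. *)
Definition overlap r q (U : 'M[F]_(r, n1)) (V : 'M[F]_(r, n2))
    (U' : 'M[F]_(q, n1)) (V' : 'M[F]_(q, n2)) (i : 'I_r) (j : 'I_q) : R :=
  ReF ((U *m ctrmx U') i j * conjF ((V *m ctrmx V') i j)).

Lemma rdot_svdmx r q (U : 'M[F]_(r, n1)) (V : 'M[F]_(r, n2)) (s : 'rV[R]_r)
    (U' : 'M[F]_(q, n1)) (V' : 'M[F]_(q, n2)) (t : 'rV[R]_q) :
  rdot (svdmx U s V) (svdmx U' t V') =
  \sum_i \sum_j s 0 i * t 0 j * overlap U V U' V' i j.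
Proof.
rewrite {1}/svdmx -mulmxA rdot_mulr ctrmxK rdot_mull /svdmx !mulmxA.
rewrite -[_ *m V' *m _]mulmxA -[V' *m _]ctrmxK ctrmxM ctrmxK rdotE.
apply: eq_bigr => i _; rewrite (bigD1 i)//= big1 ?addr0 => [|j ji].
  rewrite !mxE eqxx mulr1n ReFZ ReF_conj raddf_sum mulr_sumr.
  apply: eq_bigr => j _; rewrite -mulrA /overlap; congr (_ * _).
  move: (U *m _) (V *m _) => P Q; rewrite mul_mx_diag -[RHS]ReFZ.
  by rewrite /= !mxE; congr ReF; ring.
by rewrite !mxE eq_sym (negbTE ji) mul0r raddf0.
Qed.

Lemma rdot_svdmx_same r (U : 'M[F]_(r, n1)) (V : 'M[F]_(r, n2))
    (s t : 'rV[R]_r) :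
  orthorows U -> orthorows V ->
  rdot (svdmx U s V) (svdmx U t V) = \sum_i s 0 i * t 0 i.
Proof.
move=> UU VV; rewrite rdot_svdmx; apply: eq_bigr => i _.
rewrite (bigD1 i)//= big1 ?addr0 => [|j ji].
  rewrite /overlap UU VV !mxE eqxx /= conjF1 mulr1.
  by rewrite -(rmorph1 (@ofReal R k)) ReF_ofReal mulr1.
by rewrite /overlap UU mxE eq_sym (negbTE ji) mul0r raddf0 mulr0.
Qed.

Lemma bessel p r n (Q : 'M[F]_(r, n)) (W : 'M[F]_(p, n)) : orthorows Q ->
  rdot (W *m ctrmx Q) (W *m ctrmx Q) <= rdot W W.
Proof.
move=> QQ; have := rdot_ge0 (W - W *m ctrmx Q *m Q).
have e1 : rdot (W *m ctrmx Q *m Q) W = rdot (W *m ctrmx Q) (W *m ctrmx Q).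
  by rewrite rdot_mull.
have e2 : rdot (W *m ctrmx Q *m Q) (W *m ctrmx Q *m Q)
        = rdot (W *m ctrmx Q) (W *m ctrmx Q).
  by rewrite rdot_mull -mulmxA QQ mulmx1.
rewrite !rdot_lin [rdot W (_ *m Q)]rdotC e1 e2; lra.
Qed.

Lemma overlap_row r q n (U : 'M[F]_(r, n)) (U' : 'M[F]_(q, n)) i :
  orthorows U -> orthorows U' ->
  \sum_j ReF ((U *m ctrmx U') i j * conjF ((U *m ctrmx U') i j)) <= 1.
Proof.
move=> UU UU'; have := bessel (row i U) UU'.
have -> : rdot (row i U) (row i U) = 1.
  apply/orthorows_rV; apply/matrixP => a b; rewrite !ord1 mxE.
  have /matrixP /(_ i i) := UU; rewrite mxE !mxE eqxx => <-.
  by apply: eq_bigr => j _; rewrite !mxE.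
rewrite rdotE big_ord1 => h; apply: le_trans h; rewrite le_eqVlt; apply/orP; left.
by apply/eqP; apply: eq_bigr => j _; rewrite -row_mul !mxE.
Qed.

Lemma overlap_col r q n (U : 'M[F]_(r, n)) (U' : 'M[F]_(q, n)) j :
  orthorows U -> orthorows U' ->
  \sum_i ReF ((U *m ctrmx U') i j * conjF ((U *m ctrmx U') i j)) <= 1.
Proof.
move=> UU UU'; apply: le_trans (overlap_row j UU' UU).
rewrite le_eqVlt; apply/orP; left; apply/eqP; apply: eq_bigr => i _.
have -> : (U' *m ctrmx U) j i = conjF ((U *m ctrmx U') i j).
  by rewrite -[U' *m _]ctrmxK ctrmxM ctrmxK !mxE.
by rewrite conjFK mulrC.
Qed.

(* |overlap| is bounded by the mean of |UU'^*|^2 and |VV'^*|^2, which is a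
   doubly substochastic array. *)
Lemma overlap_sum_le r q (U : 'M[F]_(r, n1)) (V : 'M[F]_(r, n2))
    (U' : 'M[F]_(q, n1)) (V' : 'M[F]_(q, n2))
    (C : 'I_r -> 'I_q -> R) (a : 'I_r -> R) (b : 'I_q -> R) :
  orthorows U -> orthorows V -> orthorows U' -> orthorows V' ->
  (forall i, 0 <= a i) -> (forall j, 0 <= b j) ->
  (forall i j, 0 <= C i j) -> (forall i j, C i j <= a i + b j) ->
  \sum_i \sum_j C i j * overlap U V U' V' i j <= \sum_i a i + \sum_j b j.
Proof.
move=> UU VV UU' VV' a0 b0 C0 Cab.
pose P i j : R := ReF ((U *m ctrmx U') i j * conjF ((U *m ctrmx U') i j)).
pose Q i j : R := ReF ((V *m ctrmx V') i j * conjF ((V *m ctrmx V') i j)).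
have P0 i j : 0 <= P i j := ReF_conj_ge0 _.
have Q0 i j : 0 <= Q i j := ReF_conj_ge0 _.
pose D i j := (P i j + Q i j) / 2.
have Drow i : \sum_j D i j <= 1.
  rewrite -mulr_suml big_split /=; have := overlap_row i UU UU'.
  have := overlap_row i VV VV'; rewrite -/(P i _) -/(Q i _); lra.
have Dcol j : \sum_i D i j <= 1.
  rewrite -mulr_suml big_split /=; have := overlap_col j UU UU'.
  have := overlap_col j VV VV'; rewrite -/(P _ j) -/(Q _ j); lra.
(* [C] being nonnegative, the overlap may be replaced by [D], and then [C] by a + b; row and column
   sums of [D] are at most 1. *)
apply: (@le_trans _ _ (\sum_i \sum_j (a i * D i j + b j * D i j))).
  apply: ler_sum => i _; apply: ler_sum => j _.
  have mD : overlap U V U' V' i j <= D i j.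
    have := ReF_mul_le ((U *m ctrmx U') i j) (conjF ((V *m ctrmx V') i j)).
    rewrite conjFK [conjF _ * _]mulrC /D -/(P i j) -/(Q i j) -/(overlap U V U' V' i j).
    lra.
  apply: le_trans (ler_wpM2l (C0 i j) mD) _; rewrite -mulrDl.
  by rewrite ler_wpM2r// divr_ge0// addr_ge0.
under eq_bigr do rewrite big_split /= -mulr_sumr.
rewrite big_split /= [X in _ + X]exchange_big /= lerD//.
  by apply: ler_sum => i _; rewrite ler_piMr.
by apply: ler_sum => j _; rewrite -mulr_sumr ler_piMr.
Qed.

End TwoBases.

(** * Hard thresholding of singular values *)

Section HardThreshold.
Variables (R : realType) (k : RorC) (n1 n2 : nat).
Local Notation F := (scalarF R k).
Local Notation M := 'M[F]_(n1, n2).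

(** With [lo = hi] this is the usual hard thresholding, as a relation because a singular value equal
    to the threshold may be kept or dropped. With [lo < hi] it also says that no singular value lies
    strictly between. *)
Definition hard_threshold (lo hi : R) (Z T : M) : Prop :=
  exists r (U : 'M[F]_(r, n1)) (V : 'M[F]_(r, n2)) (z t : 'rV[R]_r),
    [/\ orthorows U, orthorows V, Z = svdmx U z V, T = svdmx U t V &
      forall i, (t 0 i = 0 /\ 0 <= z 0 i <= lo) \/
                (t 0 i = z 0 i /\ hi <= z 0 i)].

Lemma hard_threshold_exist (s : R) (Z : M) : 0 < s ->
  exists T, hard_threshold s s Z T.
Proof.
move=> s0; have [r [z [U [V [UU VV z0 ZE]]]]] := svd_pos Z.
pose t : 'rV[R]_r := \row_i (if s <= z 0 i then z 0 i else 0).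
exists (svdmx U t V), r, U, V, z, t; split=> // i.
rewrite mxE; case: ifPn => [h|]; [by right|rewrite -ltNge => h; left].
by rewrite !ltW.
Qed.

Lemma hard_threshold_le lo hi (Z T : M) : 0 <= hi ->
  hard_threshold lo hi Z T -> rdot T T <= rdot Z Z.
Proof.
move=> hi0 [r [U [V [z [t [UU VV -> -> h]]]]]].
rewrite !rdot_svdmx_same//; apply: ler_sum => i _.
by case: (h i) => -[-> _]; rewrite ?mul0r -?expr2 ?sqr_ge0.
Qed.

(** With s^2 = mu, strong growth of mu rank + |.|^2 away from T. Since <T, Z> = |T|^2, it is
    equivalent to 2<W, Z> - 2(1 - c)<W, T> <= s^2 rank W + c|W|^2 + c|T|^2 - s^2 rank T, which is
    compared entrywise in the two singular bases. *)
Lemma rank_growth (s c : R) (Z T W : M) : 0 < s -> 0 < c <= 1 ->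
  hard_threshold (c * s) (s / c) Z T ->
  s ^+ 2 * (\rank T)%:R + rdot T T + 2 * rdot (W - T) Z
    + (1 - c) * rdot (W - T) (W - T) <= s ^+ 2 * (\rank W)%:R + rdot W W.
Proof.
move=> s0 /andP[c0 c1] [r [U [V [z [t [UU VV ZE TE h]]]]]].
have [q [w [U' [V' [UU' VV' w0 WE]]]]] := svd_pos W.
have rW : s ^+ 2 * q%:R <= s ^+ 2 * (\rank W)%:R.
  by rewrite ler_wpM2l ?sqr_ge0// ler_nat WE rank_svdmx_ge.
have rT : s ^+ 2 * (\rank T)%:R <= \sum_i s ^+ 2 * (t 0 i != 0)%:R.
  rewrite -mulr_sumr ler_wpM2l ?sqr_ge0// -natr_sum ler_nat TE.
  exact: rank_svdmx_le.
pose a (j : 'I_q) := s ^+ 2 + c * (w 0 j * w 0 j).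
pose b (i : 'I_r) := c * (t 0 i * t 0 i) - s ^+ 2 * (t 0 i != 0)%:R.
pose C (j : 'I_q) (i : 'I_r) := 2 * (w 0 j * z 0 i) - 2 * (1 - c) * (w 0 j * t 0 i).
have big i : s / c <= z 0 i -> 0 < z 0 i /\ s <= c * z 0 i.
  rewrite ler_pdivrMr// mulrC => cz; split=> //.
  by rewrite -(pmulr_rgt0 _ c0) (lt_le_trans s0).
have hC : \sum_j \sum_i C j i * overlap U' V' U V j i <= \sum_j a j + \sum_i b i.
  apply: overlap_sum_le => //.
  - by move=> j; rewrite addr_ge0 ?sqr_ge0// mulr_ge0 ?ltW// mulr_gt0.
  (* A kept value satisfies s <= c z, so s^2 <= c^2 z^2 <= c z^2. *)
  - move=> i; rewrite /b; case: (h i) => -[-> hz].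
      by rewrite eqxx !mulr0 subrr.
    have [z0 cz] := big i hz; rewrite (gt_eqF z0) /= mulr1.
    have := ler_pM (ltW s0) (ltW s0) cz cz => h1.
    have h2 : c * (c * (z 0 i * z 0 i)) <= c * (z 0 i * z 0 i).
      by rewrite ler_piMl// mulr_ge0 ?ltW// mulr_gt0.
    rewrite subr_ge0 expr2; apply: le_trans h1 _; lra.
  - move=> j i; have wj := w0 j; rewrite /C; case: (h i) => -[-> hz].
      by case/andP: hz => hz _; rewrite !mulr0 subr0 !mulr_ge0// ltW.
    have [z0 cz] := big i hz.
    have -> : 2 * (w 0 j * z 0 i) - 2 * (1 - c) * (w 0 j * z 0 i)
       = 2 * (c * (w 0 j * z 0 i)) by ring.
    by rewrite !mulr_ge0// ltW.
  (* A dropped z is at most c s, so 2wz <= 2cws <= c w^2 + c s^2. For a kept z the claim is 2cwz <=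
     c w^2 + c z^2, the terms s^2 cancelling. *)
  - move=> j i; have wj := w0 j; rewrite /C /a /b; case: (h i) => -[-> hz].
      rewrite eqxx !mulr0 !subr0 addr0; case/andP: hz => z0 zs.
      have h1 : w 0 j * z 0 i <= w 0 j * (c * s) by rewrite ler_wpM2l// ltW.
      have := mulr_ge0 (ltW c0) (sqr_ge0 (w 0 j - s)).
      have : 0 <= (1 - c) * s ^+ 2 by rewrite mulr_ge0 ?sqr_ge0// subr_ge0.
      lra.
    have [z0 cz] := big i hz; rewrite (gt_eqF z0) /= mulr1.
    have := mulr_ge0 (ltW c0) (sqr_ge0 (w 0 j - z 0 i)).
    lra.
have eC : \sum_j \sum_i C j i * overlap U' V' U V j i
    = 2 * rdot W Z - 2 * (1 - c) * rdot W T.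
  rewrite WE ZE TE !rdot_svdmx !mulr_sumr -sumrB; apply: eq_bigr => j _.
  rewrite !mulr_sumr -sumrB; apply: eq_bigr => i _; rewrite /C; ring.
have ea : \sum_j a j = s ^+ 2 * q%:R + c * rdot W W.
  rewrite WE rdot_svdmx_same// big_split /= sumr_const card_ord.
  by rewrite mulr_natr mulr_sumr.
have eb : \sum_i b i = c * rdot T T - \sum_i s ^+ 2 * (t 0 i != 0)%:R.
  by rewrite TE rdot_svdmx_same// mulr_sumr -sumrB.
have eT : rdot T Z = rdot T T.
  rewrite ZE TE !rdot_svdmx_same//; apply: eq_bigr => i _.
  by case: (h i) => -[-> _]//; rewrite !mul0r.
move: hC; rewrite eC ea eb !rdot_lin [rdot T W]rdotC eT; lra.
Qed.

(** Since <X, Y> = |X|^2 and <T, Z> = |T|^2, the claim is <X, Z> + <Y, T> - 2(1 - c)<X, T> <= c|X|^2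
    + c|T|^2. The gap is required of Z only; Y is thresholded at [s]. *)
Lemma threshold_monotone (s c : R) (Z T Y X : M) : 0 < s -> 0 < c <= 1 ->
  hard_threshold (c * s) (s / c) Z T -> hard_threshold s s Y X ->
  (1 - c) * rdot (X - T) (X - T) <= rdot (X - T) (Y - Z).
Proof.
move=> s0 /andP[c0 c1] [r [U [V [z [t [UU VV ZE TE h]]]]]].
move=> [q [U' [V' [y [x [UU' VV' YE XE g]]]]]].
pose a (j : 'I_q) := c * (x 0 j * x 0 j).
pose b (i : 'I_r) := c * (t 0 i * t 0 i).
pose C (j : 'I_q) (i : 'I_r) :=
  x 0 j * z 0 i + y 0 j * t 0 i - 2 * (1 - c) * (x 0 j * t 0 i).
have big i : s / c <= z 0 i -> 0 < z 0 i /\ s <= c * z 0 i.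
  rewrite ler_pdivrMr// mulrC => cz; split=> //.
  by rewrite -(pmulr_rgt0 _ c0) (lt_le_trans s0).
have hC : \sum_j \sum_i C j i * overlap U' V' U V j i <= \sum_j a j + \sum_i b i.
  apply: overlap_sum_le => //.
  - by move=> j; rewrite mulr_ge0 ?(ltW c0)// -expr2 sqr_ge0.
  - by move=> j; rewrite mulr_ge0 ?(ltW c0)// -expr2 sqr_ge0.
  - move=> j i; rewrite /C; case: (h i) => -[-> hz]; case: (g j) => -[-> gy].
    + by rewrite !mulr0 mul0r subr0 addr0.
    + case/andP: hz => z0 _; rewrite !mulr0 subr0 addr0 mulr_ge0//.
      exact: le_trans (ltW s0) gy.
    + case/andP: gy => y0 _; have [z0 _] := big i hz.
      by rewrite !mul0r mulr0 subr0 add0r mulr_ge0// ltW.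
    + have [z0 _] := big i hz; have y0 := lt_le_trans s0 gy.
      have := mulr_ge0 (ltW c0) (ltW (mulr_gt0 y0 z0)); lra.
  (* If only y is kept, then z <= c s <= c y; if only z is kept, then y <= s <= c z; if both are,
     2cyz <= c y^2 + c z^2. *)
  - move=> j i; rewrite /C /a /b; case: (h i) => -[-> hz]; case: (g j) => -[-> gy].
    + by rewrite !mulr0 mul0r subr0 !addr0.
    + case/andP: hz => z0 zs; have y0 := lt_le_trans s0 gy.
      rewrite !mulr0 subr0 !addr0.
      have h1 : y 0 j * z 0 i <= y 0 j * (c * s) by rewrite ler_wpM2l// ltW.
      have : y 0 j * (c * s) <= y 0 j * (c * y 0 j).
        by rewrite ler_wpM2l ?ler_wpM2l// ltW.
      lra.
    + case/andP: gy => y0 ys; have [z0 cz] := big i hz.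
      rewrite !mul0r !mulr0 subr0 !add0r.
      have h1 : y 0 j * z 0 i <= s * z 0 i by rewrite ler_wpM2r// ltW.
      have : s * z 0 i <= c * z 0 i * z 0 i by rewrite ler_wpM2r// ltW.
      lra.
    + have := mulr_ge0 (ltW c0) (sqr_ge0 (y 0 j - z 0 i)).
      lra.
have eC : \sum_j \sum_i C j i * overlap U' V' U V j i
    = rdot X Z + rdot Y T - 2 * (1 - c) * rdot X T.
  rewrite XE YE ZE TE !rdot_svdmx !mulr_sumr -big_split -sumrB.
  apply: eq_bigr => j _ /=; rewrite !mulr_sumr -big_split -sumrB.
  apply: eq_bigr => i _; rewrite /C /=; ring.
have ea : \sum_j a j = c * rdot X X.
  by rewrite XE rdot_svdmx_same// -mulr_sumr.
have eb : \sum_i b i = c * rdot T T.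
  by rewrite TE rdot_svdmx_same// -mulr_sumr.
have eT : rdot T Z = rdot T T.
  rewrite ZE TE !rdot_svdmx_same//; apply: eq_bigr => i _.
  by case: (h i) => -[-> _]//; rewrite !mul0r.
have eX : rdot X Y = rdot X X.
  rewrite YE XE !rdot_svdmx_same//; apply: eq_bigr => i _.
  by case: (g i) => -[-> _]//; rewrite !mul0r.
move: hC; rewrite eC ea eb !rdot_lin [rdot T X]rdotC [rdot T Y]rdotC eT eX; lra.
Qed.

End HardThreshold.

(** * The quadratic envelope of the rank *)

Section Envelope.
Variables (R : realType) (k : RorC) (n1 n2 : nat) (mu : R).
Hypothesis mu_ge0 : 0 <= mu.
Local Notation F := (scalarF R k).
Local Notation M := 'M[F]_(n1, n2).
Implicit Types W X Y : M.

Let f : M -> \bar R := mu_rank mu.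

Lemma mu_rank_ge0 X : 0 <= mu * (\rank X)%:R.
Proof. by rewrite mulr_ge0. Qed.

Lemma S2_fin Y : S2 f Y \is a fin_num.
Proof.
apply/fin_numPlt/andP; split.
  apply: lt_le_trans (ereal_sup_ubound (_ : _ (- f 0 - (frob (0 - Y) ^+ 2)%:E)%E)).
    by rewrite -EFinN -EFinB ltNyr.
  by exists 0.
apply: le_lt_trans (ltry 0); apply: ge_ereal_sup => _ [X _ <-].
rewrite -EFinN -EFinB lee_fin; have := mu_rank_ge0 X.
have := sqr_ge0 (frob (X - Y)); lra.
Qed.

Let g Y := fine (S2 f Y).

Lemma S2_ge X Y : - (mu * (\rank X)%:R) - rdot (X - Y) (X - Y) <= g Y.
Proof.
rewrite -lee_fin fineK ?S2_fin//; apply: ereal_sup_ubound; exists X => //.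
by rewrite frob2.
Qed.

Lemma S2_le Y c :
  (forall X, - (mu * (\rank X)%:R) - rdot (X - Y) (X - Y) <= c) -> g Y <= c.
Proof.
move=> h; rewrite -lee_fin fineK ?S2_fin//; apply: ge_ereal_sup => _ [X _ <-].
by rewrite frob2 lee_fin.
Qed.

Lemma Q2_fin X : Q2 f X \is a fin_num.
Proof.
apply/fin_numPlt/andP; split.
  apply: lt_le_trans (ereal_sup_ubound (_ : _ (- S2 f 0 - (frob (0 - X) ^+ 2)%:E)%E)).
    by rewrite -(fineK (S2_fin 0)) -EFinN -EFinB ltNyr.
  by exists 0.
apply: le_lt_trans (ltry (mu * (\rank X)%:R)).
apply: ge_ereal_sup => _ [Y _ <-].
rewrite -(fineK (S2_fin Y)) -EFinN -EFinB lee_fin frob2.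
have := S2_ge X Y; rewrite /g -(opprB X Y) rdotNl rdotNr opprK; lra.
Qed.

(** The envelope is finite, so it is handled as a real-valued function. *)
Definition renv X : R := fine (Q2 f X).

Lemma renvE X : Q2 (mu_rank mu) X = (renv X)%:E.
Proof. by rewrite /renv fineK// Q2_fin. Qed.

Lemma renv_ge_S2 X Y : - g Y - rdot (Y - X) (Y - X) <= renv X.
Proof.
rewrite -lee_fin fineK ?Q2_fin//; apply: ereal_sup_ubound; exists Y => //.
by rewrite frob2 -(fineK (S2_fin Y)).
Qed.

Lemma renv_le_S2 X c :
  (forall Y, - g Y - rdot (Y - X) (Y - X) <= c) -> renv X <= c.
Proof.
move=> h; rewrite -lee_fin fineK ?Q2_fin//; apply: ge_ereal_sup => _ [Y _ <-].
rewrite frob2 -(fineK (S2_fin Y)) -EFinN -EFinB lee_fin.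
exact: h.
Qed.

Lemma renv_le X : renv X <= mu * (\rank X)%:R.
Proof.
apply: renv_le_S2 => Y; have := S2_ge X Y.
rewrite -(opprB X Y) rdotNl rdotNr opprK; lra.
Qed.

(** An affine minorant of mu rank W + |W|^2 with slope 2Y bounds [S2] at Y from above, and Y then
    competes in the outer supremum defining the envelope at X. *)
Lemma renv_ge X Y a :
  (forall W, a + 2 * rdot (W - X) Y <= mu * (\rank W)%:R + rdot W W) ->
  a <= renv X + rdot X X.
Proof.
move=> h; have := renv_ge_S2 X Y.
have : g Y <= - a + 2 * rdot X Y - rdot Y Y.
  apply: S2_le => W; have := h W.
  rewrite !rdot_lin [rdot Y W]rdotC; lra.
rewrite !rdot_lin [rdot Y X]rdotC; lra.
Qed.

(** Convexity of [renv] + |.|^2, a supremum of affine functions; the last term is the convexity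
    defect of |.|^2. *)
Lemma renv_segment X D t : 0 <= t <= 1 ->
  renv (X + ofReal k t *: D) <=
  (1 - t) * renv X + t * renv (X + D) + t * (1 - t) * rdot D D.
Proof.
move=> /andP[t0 t1]; apply: renv_le_S2 => W.
have h1 : (1 - t) * (- g W - rdot (W - X) (W - X)) <= (1 - t) * renv X.
  by rewrite ler_wpM2l ?renv_ge_S2// subr_ge0.
have h2 : t * (- g W - rdot (W - (X + D)) (W - (X + D))) <= t * renv (X + D).
  by rewrite ler_wpM2l ?renv_ge_S2.
move: h1 h2; rewrite !opprD !addrA; move: (W - X) => V.
rewrite !rdot_lin [rdot D V]rdotC; lra.
Qed.

End Envelope.

(** * Stationary points *)

Section Topology.
Variables (R : realType) (k : RorC).
Local Notation F := (scalarF R k).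

Lemma ge0_ofReal (x : F) : 0 <= x -> x = ofReal k (ReF x).
Proof.
move: x; case: k => // -[a b] /ger0_Im /= ->.
by [].
Qed.

Lemma ReF_ge0 (x : F) : 0 <= x -> 0 <= ReF x.
Proof. by move: x; case: k => // x; rewrite lecE => /andP[]. Qed.

Lemma ltr_ofReal (x y : R) : (ofReal k x < ofReal k y) = (x < y).
Proof. by case: k => //; exact: ltcR. Qed.

Lemma normr_ofReal (t : R) : 0 <= t -> `|ofReal k t| = ofReal k t.
Proof.
by move=> t0; apply: ger0_norm; move: t0; case: k => //; rewrite -ler0c.
Qed.

Lemma near_line (x d : F) (P : set F) : nbhs x P ->
  \forall t \near 0^'+, P (x + ofReal k t * d).
Proof.
move=> /nbhs_ballP[e /= e0 eP].
have eE := ge0_ofReal (ltW e0); have dE := ge0_ofReal (normr_ge0 d).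
have d0 := ReF_ge0 (normr_ge0 d).
have e0' : 0 < ReF e by rewrite -ltr_ofReal rmorph0 -eE.
have d1 : 0 < ReF `|d| + 1 by rewrite ltr_wpDl.
near=> t; apply: eP; rewrite -ball_normE /ball_ /=.
have t0 : 0 < t by near: t; exact: nbhs_right_gt.
rewrite opprD addrA subrr add0r normrN normrM normr_ofReal ?ltW// dE eE.
rewrite -rmorphM /= ltr_ofReal.
apply: (@le_lt_trans _ _ (t * (ReF `|d| + 1))).
  by rewrite ler_wpM2l ?lerDl ?ltW.
rewrite -ltr_pdivlMr//; near: t; apply: nbhs_right_lt.
by rewrite divr_gt0.
Unshelve. all: by end_near. Qed.

Lemma near_segment n1 n2 (X D : 'M[F]_(n1, n2)) (B : set 'M[F]_(n1, n2)) :
  nbhs X B -> \forall t \near 0^'+, B (X + ofReal k t *: D).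
Proof.
move=> [P XP PB].
have : \forall t \near 0^'+,
    forall i, forall j, P i j (X i j + ofReal k t * D i j).
  by apply: filter_forall => i; apply: filter_forall => j; exact: near_line.
by apply: filterS => t h; apply: PB => i j; rewrite !mxE; exact: h.
Qed.

End Topology.

Section Stationary.
Variables (R : realType) (k : RorC) (n1 n2 m : nat) (mu : R).
Local Notation F := (scalarF R k).
Local Notation M := 'M[F]_(n1, n2).
Variables (A : {linear M -> 'cV[F]_m}) (b : 'cV[F]_m).
Hypothesis mu_ge0 : 0 <= mu.

Let q := @renv R k n1 n2 mu.

Lemma Rmu_regE X :
  Rmu_reg mu A b X = (q X + rdot (A X - b) (A X - b))%:E.
Proof. by rewrite /Rmu_reg renvE// frob2. Qed.

Lemma linearDZ X D (t : R) : A (X + ofReal k t *: D) = A X + ofReal k t *: A D.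
Proof. by rewrite linearD linearZ. Qed.

(** Along X + tD, convexity bounds the increment of the functional by t L + t^2 |A D|^2, where L is
    the right side of the claim. A negative L would make the difference quotient negative and
    bounded away from 0 for small t. *)
Lemma stationary_slope X D : stationary (Rmu_reg mu A b) X ->
  0 <= q (X + D) - q X + rdot D D + 2 * rdot (A X - b) (A D).
Proof.
move=> st; have [->|D0] := eqVneq D 0.
  by rewrite addr0 subrr rdot0l linear0 rdotC rdot0l mulr0 !addr0.
set L := (X in 0 <= X); rewrite leNgt; apply/negP => L0.
have fD := frob_gt0 D0.
(* Half of the slope -L/|D|; the other half absorbs t^2 |A D|^2. *)
pose e := - L / (2 * frob D).
have e0 : 0 < e by rewrite divr_gt0 ?oppr_gt0// mulr_gt0.
move: st; rewrite /stationary limf_einfE => st.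
have e1 : ((- e)%:E < 0)%E by rewrite lte_fin oppr_lt0.
have /ereal_sup_gt[_ [B XB <-] eB] := lt_le_trans e1 st.
have N0 : 0 <= rdot (A D) (A D) := rdot_ge0 _.
(* The last bound on t gives t |A D|^2 < -L/2; the summand 1 keeps the denominator positive when A D
   = 0. *)
have : \forall t \near 0^'+, [/\ (X + ofReal k t *: D != X ->
    B (X + ofReal k t *: D)), 0 < t, t < 1
    & t < - L / (2 * (rdot (A D) (A D) + 1))].
  near=> t; split; near: t.
  - exact: (@near_segment R k _ _ X D _ XB).
  - exact: nbhs_right_gt.
  - exact: nbhs_right_lt.
  - by apply: nbhs_right_lt; rewrite divr_gt0 ?oppr_gt0// mulr_gt0// ltr_wpDl.
case/(@filter_ex _ _ (at_right_proper_filter (0 : R))) => t [Bt t0 t1 tL].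
have tD0 : ofReal k t *: D != 0.
  by rewrite scaler_eq0 negb_or D0 fmorph_eq0 gt_eqF.
have {}Bt : B (X + ofReal k t *: D).
  by apply: Bt; rewrite -subr_eq0 addrAC subrr add0r.
have := lt_le_trans eB (ereal_inf_lbound (ex_intro2 _ _ _ Bt erefl)).
rewrite !Rmu_regE -EFinB -EFinM lte_fin [X + _ - X]addrAC subrr add0r.
have -> : frob (ofReal k t *: D) = t * frob D.
  rewrite !frobE rdotZl rdotZr mulrA sqrtrM ?mulr_ge0 ?ltW//.
  by rewrite -expr2 sqrtr_sqr gtr0_norm.
rewrite ltr_pdivlMr ?mulr_gt0//.
have -> : - e * (t * frob D) = t * (L / 2).
  by rewrite /e; field; rewrite gt_eqF.
have tL' : 2 * (t * (t * rdot (A D) (A D))) < t * - L.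
  move: tL; rewrite ltr_pdivlMr ?mulr_gt0 ?ltr_wpDl// => tL.
  rewrite mulrCA ltr_pM2l//; apply: le_lt_trans tL.
  have := mulr_ge0 (ltW t0) N0; have := ltW t0; lra.
have := @renv_segment R k n1 n2 mu mu_ge0 X D t.
rewrite (ltW t0) (ltW t1) => /(_ isT).
have := mulr_ge0 (ltW t0) (mulr_ge0 (ltW t0) (rdot_ge0 D)).
have -> : A (X + ofReal k t *: D) - b = A X - b + ofReal k t *: A D.
  by rewrite linearDZ addrAC.
move: tL'; rewrite /L -/q; move: (A X - b) => r.
rewrite ![rdot (r + _) _]rdotDl ![rdot _ (r + _)]rdotDr !rdotZl !rdotZr.
rewrite [rdot (A D) r]rdotC; lra.
Unshelve. all: by end_near. Qed.

Lemma stationary_subgradient X Y : stationary (Rmu_reg mu A b) X ->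
  q X + rdot X X + 2 * rdot (X - adjoint A (A X) + adjoint A b) (Y - X)
    <= q Y + rdot Y Y.
Proof.
move=> /(@stationary_slope X (Y - X)); rewrite [X + (Y - X)]addrC subrK.
have e y D : rdot (adjoint A y) D = rdot y (A D).
  by rewrite rdotC -rdot_adjoint rdotC.
rewrite !rdot_lin !e !linearB /= !rdot_lin [rdot Y X]rdotC; lra.
Qed.

(** Exact expansion of the residual at X, arranged so that its first-order term cancels the one in
    [stationary_subgradient]. *)
Lemma residual_expand X Y :
  rdot (A Y - b) (A Y - b) - rdot (A X - b) (A X - b) = rdot Y Y - rdot X X
   - 2 * rdot (X - adjoint A (A X) + adjoint A b) (Y - X)
   + rdot (A (Y - X)) (A (Y - X)) - rdot (Y - X) (Y - X).
Proof.
have e y D : rdot (adjoint A y) D = rdot y (A D).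
  by rewrite rdotC -rdot_adjoint rdotC.
rewrite !rdot_lin !e !linearB /= !rdot_lin.
rewrite [rdot (A Y) (A X)]rdotC [rdot b _]rdotC [rdot b (A X)]rdotC [rdot Y X]rdotC.
lra.
Qed.

End Stationary.

(** * Restricted isometry constant and operator norm *)

Section Entries.
Variables (R : realType) (k : RorC) (n1 n2 : nat).
Local Notation F := (scalarF R k).
Implicit Types X : 'M[F]_(n1, n2).

Lemma rdotZ2 (x : F) X : rdot (x *: X) (x *: X) = ReF (x * conjF x) * rdot X X.
Proof.
rewrite !rdotE mulr_sumr; apply: eq_bigr => i _; rewrite mulr_sumr.
apply: eq_bigr => j _; rewrite !mxE -ReFZ -mul_conjF rmorphM /=.
by congr ReF; ring.
Qed.

Lemma entry_le_rdot X i j : ReF (X i j * conjF (X i j)) <= rdot X X.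
Proof.
rewrite rdotE (bigD1 i)//= (bigD1 j)//= -addrA lerDl addr_ge0//.
  by apply: sumr_ge0 => l _; exact: ReF_conj_ge0.
by do 2!apply: sumr_ge0 => ? _; exact: ReF_conj_ge0.
Qed.

End Entries.

Section Operator.
Variables (R : realType) (k : RorC) (n1 n2 m : nat).
Local Notation F := (scalarF R k).
Local Notation M := 'M[F]_(n1, n2).
Variable (A : {linear M -> 'cV[F]_m}).

Lemma lric_le J X : (\rank X <= J)%N ->
  (1 - lric A J) * rdot X X <= rdot (A X) (A X).
Proof.
have [-> _|X0 rX] := eqVneq X 0; first by rewrite rdot0l mulr0 rdot_ge0.
rewrite -ler_pdivlMr ?rdot_gt0// -!frob2 /lric opprB addrC subrK.
apply: ge_inf; last by exists X.
by exists 0 => _ [Y _ <-]; rewrite divr_ge0 ?sqr_ge0.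
Qed.

(** Makes the set in [opnorm] bounded, so that its supremum is an upper bound. The constant grows
    over the entries by |u + v|^2 <= 2|u|^2 + 2|v|^2. *)
Lemma linear_bounded : exists2 C : R, 0 <= C &
  forall X, rdot (A X) (A X) <= C * rdot X X.
Proof.
have [C C0 CA] : exists2 C : R, 0 <= C & forall X : M,
    rdot (\sum_p X p.1 p.2 *: A (delta_mx p.1 p.2))
         (\sum_p X p.1 p.2 *: A (delta_mx p.1 p.2)) <= C * rdot X X.
  elim: (index_enum _) => [|p s [C C0 CA]].
    by exists 0 => // X; rewrite big_nil rdot0l mul0r.
  exists (2 * rdot (A (delta_mx p.1 p.2)) (A (delta_mx p.1 p.2)) + 2 * C).
    by rewrite addr_ge0 ?mulr_ge0 ?rdot_ge0.
  move=> X; rewrite big_cons; set u := _ *: _; set v := \sum_(_ <- s) _.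
  have hv : rdot v v <= C * rdot X X := CA X.
  have hu : rdot u u <= rdot X X * rdot (A (delta_mx p.1 p.2)) (A (delta_mx p.1 p.2)).
    by rewrite rdotZ2 ler_wpM2r ?rdot_ge0 ?entry_le_rdot.
  have := rdot_le u v.
  rewrite rdotDl !rdotDr [rdot v u]rdotC; lra.
exists C => // X; apply: le_trans (CA X).
rewrite -(pair_bigA _ (fun i j => X i j *: A (delta_mx i j))) /=.
have -> : A X = \sum_i \sum_j X i j *: A (delta_mx i j).
  rewrite {1}(matrix_sum_delta X) linear_sum; apply: eq_bigr => i _.
  by rewrite linear_sum; apply: eq_bigr => j _; rewrite linearZ.
by [].
Qed.

Lemma opnorm_le X : opnorm A < 1 -> rdot (A X) (A X) <= rdot X X.
Proof.
move=> A1; have [->|X0] := eqVneq X 0; first by rewrite linear0 !rdot0l.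
have [C C0 CA] := linear_bounded.
have fX := frob_gt0 X0.
have : frob (A (ofReal k (frob X)^-1 *: X)) <= opnorm A.
  apply: ub_le_sup.
    exists (Num.sqrt C) => _ [Y /= Y1 <-]; rewrite frobE ler_wsqrtr//.
    apply: le_trans (CA Y) _; rewrite ler_piMr// -frob2 expr_le1//.
    by rewrite frobE sqrtr_ge0.
  exists (ofReal k (frob X)^-1 *: X) => //=.
  rewrite frobE rdotZl rdotZr -frob2 mulrA -invfM mulVf ?sqrtr1//.
  by rewrite mulf_neq0 ?gt_eqF.
rewrite linearZ /= => /le_lt_trans /(_ A1) /ltW.
move=> h; have : frob (ofReal k (frob X)^-1 *: A X) ^+ 2 <= 1.
  by rewrite expr_le1// frobE sqrtr_ge0.
rewrite frob2 rdotZl rdotZr.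
rewrite mulrA -invfM -expr2 frob2 mulrC ler_pdivrMr ?mul1r//.
exact: rdot_gt0.
Qed.

End Operator.


(** * Growth of the envelope and monotonicity of its subgradients *)

Section Subgradients.
Variables (R : realType) (k : RorC) (n1 n2 : nat) (mu : R).
Hypothesis mu_gt0 : 0 < mu.
Local Notation F := (scalarF R k).
Local Notation M := 'M[F]_(n1, n2).
Local Notation s := (Num.sqrt mu).

Let q : M -> R := @renv R k n1 n2 mu.

(** Each z_i satisfies one of two strict inequalities, which survives a slight decrease of c; there
    are finitely many i. *)
Lemma gap_shrink n (z : 'I_n -> R) (c : R) : 0 < c ->
  (forall i, z i \notin `[c * s, c^-1 * s]) ->
  exists2 c', 0 < c' < c & forall i, z i <= c' * s \/ s / c' <= z i.
Proof.
move=> c0 hz; have s0 : 0 < s by rewrite sqrtr_gt0.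
have lt_c := nbhs_left_lt c; have gt_0 := nbhs_left_gt c0.
have hz' : \forall c' \near c^'-, forall i, z i <= c' * s \/ s / c' <= z i.
  apply: filter_forall => i.
  have := hz i; rewrite in_itv /= negb_and -!ltNge => /orP[zc|zc].
    have zc' : z i / s < c by rewrite ltr_pdivrMr.
    apply: filterS (nbhs_left_gt zc') => c' h; left.
    by rewrite -ler_pdivrMr// ltW.
  have z0 : 0 < z i by apply: lt_trans zc; rewrite mulr_gt0// invr_gt0.
  have zc' : s / z i < c by rewrite ltr_pdivrMr// -ltr_pdivrMl.
  apply: filterS2 (nbhs_left_gt zc') gt_0 => c' h c'0; right.
  by rewrite ler_pdivrMr// mulrC -ler_pdivrMr// ltW.
have : \forall c' \near c^'-, [/\ c' < c, 0 < c'
    & forall i, z i <= c' * s \/ s / c' <= z i].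
  by apply: filterS3 lt_c gt_0 hz' => c'.
case/(@filter_ex _ _ (at_left_proper_filter c)) => c' [c'c c'0 h].
by exists c' => //; rewrite c'0.
Qed.

Lemma hard_threshold_gap (Z : M) c :
  (forall i, singular_values Z 0 i <= c * s \/ s / c <= singular_values Z 0 i) ->
  exists T, hard_threshold (c * s) (s / c) Z T.
Proof.
move=> hz; have [U [V [UU VV z0 ZE]]] := singular_values_svd Z.
pose t : 'rV[R]_(minn n1 n2) := \row_i
  (if singular_values Z 0 i <= c * s then 0 else singular_values Z 0 i).
exists (svdmx U t V), (minn n1 n2), U, V, (singular_values Z), t; split=> // i.
rewrite mxE; case: ifPn => [h|h]; first by left; rewrite z0.
by right; case: (hz i) => // h'; rewrite h' in h.
Qed.

Lemma env_growth c (Z T X : M) : 0 < c <= 1 ->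
  hard_threshold (c * s) (s / c) Z T ->
  mu * (\rank T)%:R + rdot T T + 2 * rdot (X - T) Z
    + (1 - c) * rdot (X - T) (X - T) <= q X + rdot X X.
Proof.
move=> c01 ZT; have s0 : 0 < s by rewrite sqrtr_gt0.
(* The slope is half the gradient at X of the convex quadratic minorant from [rank_growth]; its
   tangent at X is again a minorant. *)
apply: (@renv_ge _ _ _ _ _ (ltW mu_gt0) X (Z + ofReal k (1 - c) *: (X - T))) => W.
have := rank_growth W s0 c01 ZT; rewrite (sqr_sqrtr (ltW mu_gt0)) => h.
apply: le_trans h; have -> : W - T = (W - X) + (X - T) by rewrite addrA subrK.
have : 0 <= (1 - c) * rdot (W - X) (W - X).
  by rewrite mulr_ge0 ?rdot_ge0// subr_ge0; case/andP: c01.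
move: (W - X) (X - T) => E D; rewrite !rdot_lin [rdot D E]rdotC; lra.
Qed.

(** The bound does not involve e, so the second-order effect of the perturbation in [env_monotone]
    vanishes as e tends to 0. *)
Lemma perturb_bound (e : R) (Y H T X : M) : 0 < e -> e <= 1 ->
  rdot X X <= rdot (Y + ofReal k e *: H) (Y + ofReal k e *: H) ->
  rdot (X - T) H <= rdot Y Y + 2 * rdot H H + rdot T T.
Proof.
move=> e0 e1 hX.
have ee : e * (e * rdot H H) <= rdot H H.
  by rewrite mulrA ler_piMl ?rdot_ge0// mulr_ile1// ltW.
have h1 := rdot_le X H; have h2 := rdot_le T (- H).
have h3 := rdot_le Y (ofReal k e *: H); move: hX h1 h2 h3.
rewrite !rdot_lin [rdot H Y]rdotC; move: ee.
have := rdot_ge0 T; have := rdot_ge0 Y; have := rdot_ge0 H; lra.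
Qed.

Lemma env_monotone c (Z T X Y : M) : 0 < c <= 1 ->
  hard_threshold (c * s) (s / c) Z T ->
  (forall W, q X + rdot X X + 2 * rdot Y (W - X) <= q W + rdot W W) ->
  (1 - c) * rdot (X - T) (X - T) <= rdot (X - T) (Y - Z).
Proof.
move=> c01 ZT sub; have s0 : 0 < s by rewrite sqrtr_gt0.
(* Minus the gradient in X of <X - T, Y - Z> - (1 - c)|X - T|^2. *)
pose H := ofReal k (2 * (1 - c)) *: (X - T) - (Y - Z).
pose B := rdot Y Y + 2 * rdot H H + rdot T T.
have B0 : 0 <= B by rewrite !addr_ge0 ?mulr_ge0 ?rdot_ge0.
have key e : 0 < e <= 1 ->
    (1 - c) * rdot (X - T) (X - T) - rdot (X - T) (Y - Z) <= e * B.
  move=> /andP[e0 e1].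
  have [Xe hXe] := hard_threshold_exist (Y + ofReal k e *: H) s0.
  have Xe_le := hard_threshold_le (ltW s0) hXe.
  have mon := threshold_monotone s0 c01 ZT hXe.
  (* For c = 1 the gap closes and the quadratic term disappears: Y + eH is half a subgradient at
     Xe. *)
  have grow : q Xe + rdot Xe Xe + 2 * rdot (X - Xe) (Y + ofReal k e *: H)
      <= q X + rdot X X.
    have := @env_growth 1 (Y + ofReal k e *: H) Xe X.
    rewrite ltr01 lexx mul1r divr1 subrr mul0r addr0 => /(_ isT hXe).
    by apply: le_trans; rewrite !lerD2r renv_le// ltW.
  (* Monotonicity of subgradients between X and Xe, whose halves differ by eH. *)
  have eH : 0 <= rdot (Xe - X) H.
    have := sub Xe; move: grow; rewrite -(opprB Xe X) !rdot_lin -(pmulr_rge0 _ e0).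
    rewrite [rdot Y Xe]rdotC [rdot Y X]rdotC; lra.
  have bnd : e * rdot (Xe - T) H <= e * B.
    by rewrite ler_pM2l//; exact: perturb_bound Xe_le.
  have Dd : Xe - T = (X - T) + (Xe - X) by rewrite [RHS]addrC addrA subrK.
  move: mon bnd.
  have -> : Y + ofReal k e *: H - Z = (Y - Z) + ofReal k e *: H by rewrite addrAC.
  have -> : rdot (Xe - T) (Y - Z + ofReal k e *: H) =
      rdot (Xe - T) (Y - Z) + e * rdot (Xe - T) H by rewrite rdotDr rdotZr.
  rewrite Dd.
  (* By concavity, passing from X to Xe changes the function whose gradient is -H by at most -<Xe -
     X, H> <= 0. *)
  move: eH; rewrite {1}/H; move: (Xe - X) (X - T) (Y - Z) => d D G.
  have : 0 <= (1 - c) * rdot d d.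
    by rewrite mulr_ge0 ?rdot_ge0// subr_ge0; case/andP: c01.
  move: (rdot (D + d) H) => r.
  rewrite !rdot_lin [rdot d D]rdotC; lra.
rewrite -subr_le0 leNgt; apply/negP; set dl := (X in 0 < X) => dl0.
have dB : 0 < dl + B + 1 by rewrite ltr_wpDl ?ltr01// addr_ge0// ltW.
(* For this e, e B < dl, which contradicts [key]. *)
have e01 : 0 < dl / (dl + B + 1) <= 1.
  by rewrite divr_gt0//=  ler_pdivrMr// mul1r -addrA lerDl addr_ge0.
have := key _ e01; rewrite -/dl mulrAC ler_pdivlMr// ler_pM2l//; lra.
Qed.

End Subgradients.


(** * Minimality and separation of stationary points *)

Section Main.
Variables (R : realType) (k : RorC) (n1 n2 m : nat) (mu : R).
Hypothesis mu_gt0 : 0 < mu.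
Local Notation F := (scalarF R k).
Local Notation M := 'M[F]_(n1, n2).
Variables (A : {linear M -> 'cV[F]_m}) (b : 'cV[F]_m) (K : nat).
Local Notation s := (Num.sqrt mu).
Local Notation c := (1 - lric A (2 * K)).

Let q : M -> R := @renv R k n1 n2 mu.
Let grad (X : M) : M := X - adjoint A (A X) + adjoint A b.

Lemma opnorm_lric J : opnorm A < 1 -> 1 - lric A J <= 1.
Proof.
move=> A1; rewrite /lric opprB addrC subrK.
(* If no nonzero matrix has rank at most J, the infimum is that of the empty set, which is 0 by
   convention. *)
set S := (X in inf X); have [->|/set0P[_ [X [X0 rX] _]]] := eqVneq S set0.
  by rewrite inf0.
have := lric_le A rX; rewrite /lric opprB [1 + _]addrC subrK -/S.
rewrite -ler_pdivlMr ?rdot_gt0// => /le_trans; apply.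
by rewrite ler_pdivrMr ?rdot_gt0// mul1r opnorm_le.
Qed.

Lemma lric_diff X Y : (\rank X <= K)%N -> (\rank Y <= K)%N ->
  c * rdot (Y - X) (Y - X) <= rdot (A (Y - X)) (A (Y - X)).
Proof.
move=> rX rY; apply: lric_le; apply: leq_trans (mxrank_add _ _) _.
by rewrite mxrank_opp mul2n -addnn leq_add.
Qed.

Lemma rdot_grad X Y : rdot (Y - X) (grad Y - grad X) =
  rdot (Y - X) (Y - X) - rdot (A (Y - X)) (A (Y - X)).
Proof.
have -> : grad Y - grad X = (Y - X) - adjoint A (A (Y - X)).
  have e : adjoint A (A Y) - adjoint A (A X) = adjoint A (A (Y - X)).
    apply/eqP; rewrite -subr_eq0 -rdot_eq0; apply/eqP.
    set E := (E in rdot E E).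
    by rewrite {2}/E rdotDr rdotDr !rdotNr -!rdot_adjoint -rdotNr -rdotDr -linearB subrr.
  rewrite -e /grad opprD addrACA subrr addr0 !opprB.
  rewrite [adjoint A (A X) - X]addrC addrACA.
  by rewrite [- _ + adjoint A (A X)]addrC.
by rewrite rdotDr rdotNr -rdot_adjoint.
Qed.

Section At.
Variable X : M.
Hypothesis rX : (\rank X <= K)%N.
Hypothesis stX : stationary (Rmu_reg mu A b) X.
Hypothesis c0 : 0 < c.
Hypothesis gap : forall i, singular_values (grad X) 0 i \notin `[c * s, c^-1 * s].

Let sub Y : q X + rdot X X + 2 * rdot (grad X) (Y - X) <= q Y + rdot Y Y.
Proof. exact: (stationary_subgradient (ltW mu_gt0) Y stX). Qed.

(** Let T be the thresholding of [grad X]. The subgradient inequality at T, with the envelope at T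
    at most mu rank T, and [env_growth] at X add up to (1 - c')|X - T|^2 <= 0. *)
Lemma stationary_threshold : c <= 1 -> exists2 c', 0 < c' < c &
  hard_threshold (c' * s) (s / c') (grad X) X.
Proof.
move=> c1; have [c' c'c h] := gap_shrink mu_gt0 c0 gap.
exists c' => //; have [T hT] := hard_threshold_gap h.
have [c'0 c'lt] := andP c'c.
have c'1 : c' < 1 := lt_le_trans c'lt c1.
have c'01 : 0 < c' <= 1 by rewrite c'0 ltW.
suff XT : X = T by rewrite [in X in hard_threshold _ _ _ X]XT.
have := env_growth mu_gt0 X c'01 hT.
have := sub T; have := @renv_le R k n1 n2 mu (ltW mu_gt0) T; rewrite -/q.
have k0 : 0 < 1 - c' by rewrite subr_gt0.
move=> h1 h2 h3; apply/eqP; rewrite -subr_eq0 -rdot_eq0.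
rewrite eq_le rdot_ge0 andbT -(pmulr_rle0 _ k0).
move: h2 h3; rewrite -(opprB X T) rdotNr [rdot (X - T) (grad X)]rdotC; lra.
Qed.

(** As X is its own T, [env_growth] at X reads as the inequality opposite to [renv_le]. *)
Lemma stationary_renv : c <= 1 -> q X = mu * (\rank X)%:R.
Proof.
move=> c1; have [c' /andP[c'0 c'lt] hX] := stationary_threshold c1.
have c'01 : 0 < c' <= 1 by rewrite c'0 ltW// (lt_le_trans c'lt c1).
have := env_growth mu_gt0 X c'01 hX; rewrite subrr rdot0l mulr0 rdot0l mulr0.
have := @renv_le R k n1 n2 mu (ltW mu_gt0) X; rewrite -/q -/(q X).
by move=> h1 h2; apply/eqP; rewrite eq_le; apply/andP; split; lra.
Qed.

Lemma stationary_lt Y : (\rank Y <= K)%N -> Y != X ->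
  q X + rdot (A X - b) (A X - b) < q Y + rdot (A Y - b) (A Y - b).
Proof.
move=> rY YX; have D0 : 0 < rdot (Y - X) (Y - X) by rewrite rdot_gt0// subr_eq0.
have hA := lric_diff rX rY; have hr := residual_expand A b X Y.
(* If c > 1, then |A(Y - X)|^2 exceeds |Y - X|^2 and the subgradient inequality suffices. Otherwise
   the margin is (c - c')|Y - X|^2. *)
have [c1|c1] := ltP 1 c.
  have : rdot (Y - X) (Y - X) < c * rdot (Y - X) (Y - X) by rewrite ltr_pMl.
  by have := sub Y; move: hr; rewrite -/(grad X); lra.
have [c' /andP[c'0 c'lt] hX] := stationary_threshold c1.
have c'01 : 0 < c' <= 1 by rewrite c'0 ltW// (lt_le_trans c'lt c1).
have := env_growth mu_gt0 Y c'01 hX; rewrite -(stationary_renv c1) -/q.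
have : c' * rdot (Y - X) (Y - X) < c * rdot (Y - X) (Y - X) by rewrite ltr_pM2r.
move: hr; rewrite -/(grad X) [rdot (Y - X) (grad X)]rdotC; lra.
Qed.

Lemma stationary_rank_gt Y : stationary (Rmu_reg mu A b) Y -> Y != X ->
  (K < \rank Y)%N.
Proof.
move=> stY YX; rewrite ltnNge; apply/negP => rY.
have D0 : 0 < rdot (Y - X) (Y - X) by rewrite rdot_gt0// subr_eq0.
have hA := lric_diff rX rY.
have subY W : q Y + rdot Y Y + 2 * rdot (grad Y) (W - Y) <= q W + rdot W W.
  exact: (stationary_subgradient (ltW mu_gt0) W stY).
have hD := rdot_grad X Y.
have [c1|c1] := ltP 1 c.
  have : rdot (Y - X) (Y - X) < c * rdot (Y - X) (Y - X) by rewrite ltr_pMl.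
  have := sub Y; have := subY X; move: hD; rewrite -(opprB Y X).
  rewrite rdotDr !rdotNr [rdot (Y - X) (grad Y)]rdotC [rdot (Y - X) (grad X)]rdotC.
  lra.
have [c' /andP[c'0 c'lt] hX] := stationary_threshold c1.
have c'01 : 0 < c' <= 1 by rewrite c'0 ltW// (lt_le_trans c'lt c1).
(* With D = Y - X this gives (1 - c')|D|^2 <= |D|^2 - |A D|^2 <= (1 - c)|D|^2, impossible as c' <
   c. *)
have := env_monotone mu_gt0 c'01 hX subY.
have : c' * rdot (Y - X) (Y - X) < c * rdot (Y - X) (Y - X) by rewrite ltr_pM2r.
move: hD hA; lra.
Qed.

Lemma stationary_min_rank : opnorm A < 1 -> rdot (A X - b) (A X - b) <= mu ->
  forall Y, mu * (\rank X)%:R + rdot (A X - b) (A X - b) <=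
            mu * (\rank Y)%:R + rdot (A Y - b) (A Y - b).
Proof.
move=> A1 hmu Y; have c1 := opnorm_lric (2 * K) A1.
have [rY|rY] := leqP (\rank Y) K.
  have [->//|YX] := eqVneq Y X.
  have := ltW (stationary_lt rY YX); rewrite stationary_renv// => /le_trans; apply.
  by rewrite lerD2r renv_le// ltW.
(* Beyond rank K at least one more unit of rank is paid, and its cost mu covers the whole residual
   of X. *)
have : mu * (\rank X)%:R + mu <= mu * (\rank Y)%:R.
  by rewrite -[X in _ + X]mulr1 -mulrDr ler_pM2l// natr1 ler_nat (leq_ltn_trans rX).
have := rdot_ge0 (A Y - b); lra.
Qed.

(* As |A| < 1, [min R_mu - |A W - b|^2 + |W|^2] is a convex quadratic minorant
   of [mu rank W + |W|^2], hence of its envelope. *)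
Lemma stationary_min_reg : opnorm A < 1 -> rdot (A X - b) (A X - b) <= mu ->
  forall Y, q X + rdot (A X - b) (A X - b) <= q Y + rdot (A Y - b) (A Y - b).
Proof.
move=> A1 hmu Y; have := stationary_min_rank A1 hmu.
rewrite (stationary_renv (opnorm_lric _ A1)).
set v := _ + _ => h.
suff : v - rdot (A Y - b) (A Y - b) + rdot Y Y <= q Y + rdot Y Y by lra.
(* [grad Y] is half the gradient at Y of the minorant v - |A W - b|^2 + |W|^2. *)
apply: (@renv_ge _ _ _ _ _ (ltW mu_gt0) Y (grad Y)) => W.
have := h W; have := residual_expand A b Y W; rewrite -/(grad Y).
have := opnorm_le (W - Y) A1; rewrite [rdot (W - Y) (grad Y)]rdotC; lra.
Qed.

End At.
End Main.

Theorem theorem5p1 (R : realType) (k : RorC) (n1 n2 m : nat) (mu : R)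
    (A : {linear 'M[scalarF R k]_(n1, n2) -> 'cV[scalarF R k]_m})
    (b : 'cV[scalarF R k]_m) (K : nat) (X' Z' : 'M[scalarF R k]_(n1, n2))
    (hmu : 0 < mu)
    (hK : (1 <= K)%N)
    (hdelta : lric A (2 * K) < 1)
    (hX'stat : stationary (Rmu_reg mu A b) X')
    (hX'rank : (\rank X' <= K)%N)
    (hZ' : Z' = X' - adjoint A (A X') + adjoint A b)
    (hsigma : forall i : 'I_(minn n1 n2),
        singular_values Z' 0 i \notin
          `[(1 - lric A (2 * K)) * Num.sqrt mu,
            (1 - lric A (2 * K))^-1 * Num.sqrt mu]) :
  [/\ argmin [set X | (\rank X <= K)%N] (Rmu_reg mu A b) = [set X'],
      forall X'' : 'M[scalarF R k]_(n1, n2),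
        stationary (Rmu_reg mu A b) X'' -> X'' <> X' -> (K < \rank X'')%N
    & opnorm A < 1 -> frob (A X' - b) ^+ 2 <= mu ->
        argmin [set: 'M[scalarF R k]_(n1, n2)] (Rmu mu A b) X' /\
        argmin [set: 'M[scalarF R k]_(n1, n2)] (Rmu_reg mu A b) X'].
Proof.
have c0 : 0 < 1 - lric A (2 * K) by rewrite subr_gt0.
rewrite hZ' in hsigma.
have lt_X' := stationary_lt hmu hX'rank hX'stat c0 hsigma.
split.
- apply/seteqP; split=> [X /= [rX Xmin]|X /= ->].
    apply/eqP; apply: contraT => XX'; have := Xmin _ hX'rank.
    by rewrite !Rmu_regE ?(ltW hmu)// lee_fin leNgt lt_X'.
  split=> // Y rY; rewrite !Rmu_regE ?(ltW hmu)// lee_fin.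
  by have [->//|YX] := eqVneq Y X'; rewrite ltW// lt_X'.
- move=> X'' st /eqP; exact: (stationary_rank_gt hmu hX'rank hX'stat c0 hsigma).
- rewrite frob2 => A1 hb; split; split=> // Y _.
    by rewrite /Rmu /mu_rank -!EFinD lee_fin !frob2;
       exact: (stationary_min_rank hmu hX'rank hX'stat c0 hsigma).
  rewrite !Rmu_regE ?(ltW hmu)// lee_fin.
  exact: (stationary_min_reg hmu hX'rank hX'stat c0 hsigma).
Qed.
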